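(* Let $p$ be a prime number. Then the Hasse-Witt invariant of the Pellikaan curve $\mathcal X_p$ is equal to its genus (that is, $\mathcal X_p$ is an ordinary curve).
   Context: $\mathbb K$ is the algebraic closure of $\mathbb F_p$. The Pellikaan curve $\mathcal X_p$ is the nonsingular plane projective curve over $\mathbb K$ with affine equation $xy^{p+1}+x^{p+1}+y=0$ (homogeneous equation $XY^{p+1}+X^{p+1}Z+YZ^{p+1}=0$), of genus $\mathfrak g=p(p+1)/2$. The Hasse-Witt invariant ($p$-rank) of a curve is the integer $\gamma$ such that the $p$-torsion subgroup of its Jacobian over $\mathbb K$ has order $p^\gamma$; equivalently, it is the rank of the $\mathfrak g$-fold iterate of the Cartier operator on the space of holomorphic differentials. *)

(* Defs.v *)
From HB Require Import structures.
From mathcomp Require Import all_boot all_order all_algebra.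
From mathcomp Require Import mpoly.
Set Implicit Arguments.
Unset Strict Implicit.
Unset Printing Implicit Defensive.
Import GRing.Theory.
Local Open Scope ring_scope.

Definition is_algebraic_closure (k : fieldType) (K : closedFieldType)
    (j : {rmorphism k -> K}) : Prop :=
  forall z : K, algebraicOver j z.

Definition pellikaan (p : nat) (K : fieldType) : {mpoly K[3]} :=
  let X := 'X_(Ordinal (isT : (0 < 3)%N)) in
  let Y := 'X_(Ordinal (isT : (1 < 3)%N)) in
  let Z := 'X_(Ordinal (isT : (2 < 3)%N)) in
  X * Y ^+ p.+1 + X ^+ p.+1 * Z + Y * Z ^+ p.+1.

Section Kahler.
Variables (K L : fieldType) (iota : {rmorphism K -> L}).

Record derivation (M : lmodType L) (D : L -> M) : Prop := Derivation {
  derivationD : forall u v, D (u + v) = D u + D v;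
  derivationM : forall u v, D (u * v) = u *: D v + v *: D u;
  derivationC : forall a, D (iota a) = 0 }.

(* (Om, d) is the module of Kaehler differentials of L / K, given by its      *)
(* universal property, hence only up to unique isomorphism.                   *)
Record kahler (Om : lmodType L) (d : L -> Om) : Prop := Kahler {
  kahler_derivation : derivation d;
  kahler_universal : forall (M : lmodType L) (D : L -> M), derivation D ->
    exists2 h : {linear Om -> M}, (forall u, D u = h (d u)) &
      forall h' : {linear Om -> M}, (forall u, D u = h' (d u)) -> h' =1 h }.

(* In characteristic p, these identities determine C on the differentials of  *)
(* a function field of one variable: if x is a separating element, then       *)
(* C ((f_0^p + f_1^p x + ... + f_(p-1)^p x^(p-1)) dx) = f_(p-1) dx.           *)
Record cartier (p : nat) (Om : lmodType L) (d : L -> Om) (C : Om -> Om) :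
    Prop := Cartier {
  cartierD : forall v w, C (v + w) = C v + C w;
  cartierZ : forall u w, C (u ^+ p *: w) = u *: C w;
  cartier_exact : forall u, C (d u) = 0;
  cartier_log : forall u, C (u ^+ p.-1 *: d u) = d u }.

(* The set V is a K-subspace of M of dimension n.                             *)
Definition has_dim (M : lmodType L) (V : M -> Prop) (n : nat) : Prop :=
  exists b : 'I_n -> M,
    (forall w, V w <-> exists c : 'I_n -> K, w = \sum_i iota (c i) *: b i) /\
    (forall c : 'I_n -> K,
       \sum_i iota (c i) *: b i = 0 -> forall i, c i = 0).

End Kahler.

Section PlaneCurve.
Variables (K L : fieldType) (iota : {rmorphism K -> L}).
(* The curve F = 0 in the projective plane over K, with F homogeneous.        *)
Variable F : {mpoly K[3]}.
(* The affine coordinate functions X / Z and Y / Z.                           *)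
Variables x y : L.

Definition geval (G : {mpoly K[3]}) : L :=
  mmap iota (tnth [tuple x; y; 1]) G.

(* L is the field of quotients G / H of homogeneous elements of equal degree  *)
(* of the homogeneous coordinate ring K[X, Y, Z] / (F); that such a field     *)
(* exists forces F to be irreducible.                                         *)
Record function_field : Prop := FunctionField {
  function_field_ideal : forall (n : nat) (G : {mpoly K[3]}),
    G \is n.-homog -> (geval G = 0 <-> exists Q, G = Q * F);
  function_field_frac : forall u : L, exists n (G H : {mpoly K[3]}),
    [/\ G \is n.-homog, H \is n.-homog, geval H != 0
      & u = geval G / geval H] }.

(* P is a triple of homogeneous coordinates, defined up to scaling.           *)
Definition on_curve (P : 'I_3 -> K) : Prop :=
  (exists i, P i != 0) /\ F.@[P] = 0.

Definition local_ring (P : 'I_3 -> K) (u : L) : Prop :=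
  exists n (G H : {mpoly K[3]}),
    [/\ G \is n.-homog, H \is n.-homog, H.@[P] != 0
      & u = geval G / geval H].

Variables (Om : lmodType L) (d : L -> Om).

(* w lies in the image of the differentials of the local ring of P, which is  *)
(* the stalk at P of the sheaf of differentials.                              *)
Definition regular_at (P : 'I_3 -> K) (w : Om) : Prop :=
  exists n (a b : 'I_n -> L),
    [/\ forall i, local_ring P (a i), forall i, local_ring P (b i)
      & w = \sum_i a i *: d (b i)].

Definition holomorphic (w : Om) : Prop :=
  forall P, on_curve P -> regular_at P w.

(* For a nonsingular curve, as here, this is the genus.                       *)
Definition has_genus (g : nat) : Prop := has_dim iota holomorphic g.

(* C ^ g is only p^(-g)-linear over K, but K being perfect its image is a     *)
(* K-subspace; the rank of C ^ g is the dimension of that image.              *)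
Definition has_hasse_witt_invariant (C : Om -> Om) (gamma : nat) : Prop :=
  exists2 g, has_genus g &
    has_dim iota (fun w => exists2 v, holomorphic v & w = iter g C v) gamma.

End PlaneCurve.

(* Main.v *)
Require Import Defs.
From HB Require Import structures.
From mathcomp Require Import all_boot all_order all_algebra.
From Stdlib Require Import ClassicalEpsilon.
From mathcomp Require Import mpoly.
From mathcomp Require Import zify ring.
Set Implicit Arguments.
Unset Strict Implicit.
Unset Printing Implicit Defensive.
Import GRing.Theory.
Local Open Scope ring_scope.

(** Let fx, fy, fz be the values at (x, y, 1) of the partial derivatives of
    the equation F of the curve, which has degree p + 2, and put
    omega = dx / fy.  Differentiating the equation gives du = D(u) omega for
    every function u, where D is the derivation with D x = fy and
    D y = - fx (jacobian_derivation, d_base_form); the universal property of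
    the differentials turns D into a linear form taking the value 1 at omega,
    so that omega is a basis of the differentials over the function field.

    The forms x^i y^j omega with i + j < p are a basis of the holomorphic
    differentials (holomorphicP, basis_form_free), and there are p(p+1)/2 of
    them.  They are holomorphic because the curve is smooth: at each point
    some D (X_i / X_k) X_k^2, which is a partial derivative of F up to sign,
    does not vanish (holomorphic_geval).  Conversely, let g omega be
    holomorphic.  The lines X = 0 and Y = Z meet only at (0 : 1 : 1), where F
    takes the value 1, so the curve is covered by the two charts Y <> Z and
    X <> 0.  In both of them the equation of the curve is monic in the second
    coordinate, and D maps coordinate functions to (p-1)-st powers of the
    denominator times polynomials; hence g, divided by such a power, is
    locally a quotient of polynomials with nonvanishing denominator, and
    therefore a polynomial (regular_polynomial, regular_in_chart).  Comparing
    the two polynomials bounds their degrees (two_chart_degree), so that g is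
    a polynomial of degree less than p in x and y.

    The equation reads y fy = - x^(p+1), where fy = 1 + x y^p.  Therefore
      x^i y^j omega = (-1)^j fy^(-p) x^(jp) x^(i+j) (1 + x y^p)^(p-1-j) dx,
    and after the expansion of the binomial every factor except a power of x
    is a p-th power.  As the Cartier operator C kills x^a dx unless p divides
    a + 1, a single term survives (cartier_monomial):
      C (x^i y^j omega) = (-1)^j binom(p-1-j, i) x^j y^(p-1-i-j) omega.
    The map from (i, j) to (j, p-1-i-j) permutes the pairs with i + j < p, and
    the binomials are prime to p.  So C permutes the basis up to nonzero
    scalars of the prime field; it maps the space of holomorphic
    differentials onto itself, and so do all its iterates. *)

(** * Regular functions on an affine plane curve *)

(** The Nullstellensatz in one variable, by descent on a member c of the ideal:
    the gcd of c and of a member that does not vanish at some root of c is a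
    member of smaller degree. *)
Lemma poly_ideal_one (K : closedFieldType) (I : {poly K} -> Prop) (c : {poly K}) :
    (forall q r, I q -> I r -> I (q + r)) -> (forall a q, I q -> I (a * q)) ->
    I c -> c != 0 ->
    (forall b, root c b -> exists2 q, I q & ~~ root q b) ->
  I 1.
Proof.
move=> ID IM; have [n] := ubnP (size c); elim: n c => // n IHn c le_c Ic nz_c sep.
have [sc1 | sc1] := eqVneq (size c) 1.
  have /size_poly1P[k nz_k Dc] : size c == 1 by rewrite sc1.
  have -> : 1 = (k^-1)%:P * c by rewrite Dc -polyCM mulVf.
  exact: IM.
have /closed_rootP[b rcb] := sc1.
have [q Iq nrq] := sep b rcb.
pose r := gcdp c q.
have r_c : r %| c by apply: dvdp_gcdl.
have nz_r : r != 0 by rewrite gcdp_eq0 (negPf nz_c).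
apply: (IHn r) => //.
- suff: (size r < size c)%N by move/leq_trans; apply.
  rewrite ltn_neqAle dvdp_leq // andbT; apply: contra nrq => /eqP eq_size.
  have : r %= c by rewrite -dvdp_size_eqp // eq_size.
  rewrite /eqp => /andP[_ c_r]; exact: root_dvdp (dvdp_trans c_r (dvdp_gcdr c q)) rcb.
- have [u] := Bezoutp c q; rewrite eqp_sym => /eqpfP; rewrite -/r => ->.
  by rewrite -mul_polyC; apply/IM/ID; apply: IM.
- move=> b' /(root_dvdp r_c); exact: sep.
Qed.

Lemma map_horner_eq0 (K : fieldType) (a : K) (Q : {poly {poly K}}) :
  map_poly (horner_eval a) Q = 0 -> exists S, Q = ('X - a%:P)%:P * S.
Proof.
move=> Q0; exists (\poly_(i < size Q) (Q`_i %/ ('X - a%:P))).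
apply/polyP=> i; rewrite coefCM coef_poly; case: ltnP => [lt_i | /(nth_default 0) -> //].
  rewrite mulrC divpK // dvdp_XsubCl /root.
  have := congr1 (fun q : {poly K} => q`_i) Q0.
  by rewrite coef_map coef0 /= /horner_eval => ->.
by rewrite mulr0.
Qed.

Lemma horner2_map (K : fieldType) (a b : K) (Q : {poly {poly K}}) :
  Q.[b%:P].[a] = (map_poly (horner_eval a) Q).[b].
Proof. by rewrite -{2}(hornerC b a) -[_.[a]]/(horner_eval a _) horner_map. Qed.

(* The ring of polynomials in two variables is {poly {poly K}}, with first
   coordinate 'X%:P and second coordinate 'X; ev identifies its quotient by m
   with a subring of the field L. *)
Section AffineCurve.
Variables (K : closedFieldType) (L : fieldType).
Variable ev : {rmorphism {poly {poly K}} -> L}.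
Variable m : {poly {poly K}}.
Hypothesis m_monic : m \is monic.
Hypothesis m_size : (1 < size m)%N.
Hypothesis ev_m : ev m = 0.
Hypothesis ev_ker : forall Q, ev Q = 0 -> exists S, Q = S * m.

Lemma ev_eq0_small (Q : {poly {poly K}}) : (size Q < size m)%N -> ev Q = 0 -> Q = 0.
Proof.
move=> ltQ /ev_ker[S DQ]; have [S0 | nzS] := eqVneq S 0.
  by rewrite DQ S0 mul0r.
move: ltQ; rewrite DQ size_Mmonic //; move: nzS; rewrite -size_poly_gt0; lia.
Qed.

Lemma ev_small u Q : u = ev Q -> exists2 R : {poly {poly K}}, (size R < size m)%N & u = ev R.
Proof.
move=> ->; exists (Pdiv.CommonRing.rmodp Q m).
  by rewrite Pdiv.Ring.ltn_rmodp -size_poly_gt0 ltnW.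
by rewrite {1}(Pdiv.RingMonic.rdivp_eq m_monic Q) rmorphD rmorphM ev_m mulr0 add0r.
Qed.

(** The denominator a is the resultant of m and of a representative R of H of
    smaller degree.  It is nonzero: a common factor of R and m would split m,
    up to a scalar, into two factors of smaller degree, one of which would
    vanish in L; but no nonzero polynomial of smaller degree than m does. *)
Lemma ev_denominator H : ev H != 0 ->
  exists a S, a != 0 /\ ev a%:P = ev (S * H).
Proof.
move=> nzH.
have [R ltR DR] := ev_small (erefl (ev H)).
have nzR : R != 0 by apply: contraNneq nzH => R0; rewrite DR R0 rmorph0.
suff [a [S [nza DS]]] : exists a S, a != 0 /\ ev a%:P = ev (S * R).
  by exists a, S; rewrite DS !rmorphM -DR.
have [le1 | gt1] := leqP (size R) 1.
  exists (R`_0), 1; rewrite mul1r -(size1_polyC le1); split=> //.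
  by apply: contra nzR => /eqP R0; rewrite (size1_polyC le1) R0.
have [[U V] /= _ DUV] := resultant_in_ideal gt1 m_size.
exists (resultant R m), U; split; last first.
  by rewrite DUV rmorphD !rmorphM ev_m mulr0 addr0.
rewrite resultant_eq0; set G := gcdp R m.
rewrite ltnNge negbK leqNgt; apply/negP=> G_gt1.
have nzG: G != 0 by rewrite -size_poly_gt0 ltnW.
have /Pdiv.Idomain.dvdpP[[s c'] /= nzs Ds] := dvdp_gcdr R m.
have /Pdiv.Idomain.dvdpP[[s' c] /= nzs' Ds'] := dvdp_gcdl R m.
have nzm : m != 0 by apply: monic_neq0.
have nz_evs (a : {poly K}) : a != 0 -> ev a%:P != 0.
  move=> nza; apply/eqP => /ev_eq0_small a0; case/eqP: nza; apply/polyC_inj/a0.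
  by apply: leq_ltn_trans m_size; apply: size_polyC_leq1.
have : ev G * ev c' = 0.
  by rewrite mulrC -rmorphM -Ds -mul_polyC rmorphM ev_m mulr0.
move/eqP; rewrite mulf_eq0 => /orP[/eqP G0 | /eqP c0].
  have : ev s'%:P * ev R = 0.
    by rewrite -rmorphM mul_polyC Ds' rmorphM G0 mulr0.
  by apply/eqP; rewrite mulf_neq0 ?nz_evs // -DR.
have nzc' : c' != 0.
  apply: contraNneq nzs => c'0; move/eqP: Ds.
  by rewrite c'0 mul0r scale_poly_eq0 (negPf nzm) orbF.
suff c'0 : c' = 0 by rewrite c'0 eqxx in nzc'.
apply: ev_eq0_small c0.
have -> : size m = size (s *: m) by rewrite size_scale.
rewrite Ds size_mul //.
move: G_gt1 nzc'; rewrite -size_poly_gt0 -/G; move: (size G) (size c'); lia.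
Qed.

Definition regular_everywhere (g : L) :=
  forall a b : K, m.[b%:P].[a] = 0 ->
    exists N H, H.[b%:P].[a] != 0 /\ ev H * g = ev N.

(** The polynomials Q in the second coordinate such that some lift of Q
    multiplies g into the image of ev form an ideal.  It contains the
    restriction of m to the line of abscissa a, and by regularity it has no
    zero among the points of the curve on that line, so it contains 1. *)
Lemma remove_linear_denominator g a N :
    regular_everywhere g -> ev ('X - a%:P)%:P * g = ev N ->
  exists Q, g = ev Q.
Proof.
move=> reg Dg.
pose I q := exists2 Q, map_poly (horner_eval a) Q = q & exists M, ev Q * g = ev M.
suff [Q DQ [M DM]] : I 1.
  have /map_horner_eq0[S DS] : map_poly (horner_eval a) (Q - 1) = 0.
    by rewrite rmorphB rmorph1 /= DQ subrr.
  exists (M - S * N); rewrite rmorphB rmorphM -DM -Dg.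
  have -> : Q = 1 + ('X - a%:P)%:P * S by rewrite -DS; ring.
  rewrite rmorphD rmorph1 rmorphM; ring.
apply: (@poly_ideal_one _ _ (map_poly (horner_eval a) m)).
- move=> q r [Q <- [M DM]] [Q' <- [M' DM']]; exists (Q + Q').
    by rewrite rmorphD.
  by exists (M + M'); rewrite !rmorphD mulrDl DM DM'.
- move=> c q [Q <- [M DM]]; exists (map_poly polyC c * Q).
    rewrite rmorphM /=; congr (_ * _); apply/polyP=> i.
    by rewrite !coef_map /= /horner_eval hornerC.
  by exists (map_poly polyC c * M); rewrite !rmorphM -mulrA DM.
- by exists m => //; exists 0; rewrite ev_m mul0r rmorph0.
- by rewrite monic_neq0 // monic_map.
move=> b /rootP; rewrite -horner2_map => /reg[N' [H [nzH DH]]].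
exists (map_poly (horner_eval a) H); first by exists H => //; exists N'.
by rewrite /root -horner2_map.
Qed.

(** By ev_denominator a denominator of g can be taken to depend on the first
    coordinate only; its linear factors are then removed one at a time. *)
Lemma regular_polynomial g N H :
    ev H != 0 -> ev H * g = ev N -> regular_everywhere g ->
  exists Q, g = ev Q.
Proof.
move=> nzH Dg reg; have [a [S [nza DS]]] := ev_denominator nzH.
have {nzH Dg DS} [M Dg] : exists M, ev a%:P * g = ev M.
  by exists (S * N); rewrite DS rmorphM -mulrA Dg rmorphM.
have [n] := ubnP (size a); elim: n a nza g reg M Dg => // n IHn a nza g reg M Dg lta.
have [sa1 | sa1] := eqVneq (size a) 1.
  have /size_poly1P[k nz_k Da] : size a == 1 by rewrite sa1.
  exists (((k^-1)%:P)%:P * M); rewrite rmorphM -Dg Da mulrA -rmorphM.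
  by rewrite -!polyCM mulVf // rmorph1 mul1r.
have /closed_rootP[b /factor_theorem[a1 Da]] := sa1.
have nza1 : a1 != 0 by apply: contraNneq nza => a10; rewrite Da a10 mul0r.
have [||Q DQ] := @remove_linear_denominator (ev a1%:P * g) b M.
- move=> c e /reg[N' [H' [nzH' DN']]]; exists (a1%:P * N'), H'; split=> //.
  by rewrite rmorphM mulrCA DN'.
- by rewrite mulrA -rmorphM -polyCM mulrC [_ * a1]mulrC -Da mulrC.
apply: (IHn a1 nza1 g reg Q DQ).
by move: lta; rewrite Da size_Mmonic ?monicXsubC // size_XsubC addn2.
Qed.

End AffineCurve.

(** * Charts of a projective plane curve *)

Lemma poly2_ind (K : nzRingType) (P : {poly {poly K}} -> Prop) :
    (forall c, P c%:P%:P) -> P 'X%:P -> P 'X ->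
    (forall Q R, P Q -> P R -> P (Q + R)) ->
    (forall Q R, P Q -> P R -> P (Q * R)) ->
  forall Q, P Q.
Proof.
move=> PC Pt Pv PD PM; elim/poly_ind=> [|Q a PQ]; first exact: (PC 0).
apply: (PD); first exact: (PM).
elim/poly_ind: a => [|a c Pa]; first exact: (PC 0).
by rewrite polyCD polyCM; apply: (PD) (PC c); apply: (PM).
Qed.

Section Variables.
Variables (n : nat) (K : comNzRingType).
Implicit Types G H : {mpoly K[n]}.

Lemma dhomogXU i : ('X_i : {mpoly K[n]}) \is 1.-homog.
Proof. by rewrite dhomogX /= mdeg1. Qed.

Lemma dhomogXUn i k : ('X_i ^+ k : {mpoly K[n]}) \is k.-homog.
Proof. by have := dhomogMn k (dhomogXU i); rewrite mul1n. Qed.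

Lemma dhomogC c : (c%:MP : {mpoly K[n]}) \is 0.-homog.
Proof. by rewrite -[c%:MP]mulr1 mul_mpolyC dhomogZ // dhomog1. Qed.

Lemma dhomogM_eq d e k G H :
  (d + e)%N = k -> G \is d.-homog -> H \is e.-homog -> G * H \is k.-homog.
Proof. by move=> <-; exact: dhomogM. Qed.

Lemma mderivXU (i k : 'I_n) : ('X_i : {mpoly K[n]})^`M(k) = (k == i)%:R.
Proof.
rewrite mderivX mnm1E eq_sym; case: eqP => [->|_]; last by rewrite scale0r.
by rewrite scale1r -[X in (X - _)%MM]addm0 addmC addmK mpolyX0.
Qed.

End Variables.

Section HomogeneousEvaluation.
Variables (n : nat) (K S : comNzRingType) (f : {rmorphism K -> S}).

Lemma mmap_homogZ (h : 'I_n -> S) (s : S) d (G : {mpoly K[n]}) :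
  G \is d.-homog -> mmap f (fun i => s * h i) G = s ^+ d * mmap f h G.
Proof.
move=> /dhomogP homG; rewrite /mmap mulr_sumr; apply: eq_big_seq => m /homG /= <-.
rewrite mulrCA; congr (_ * _); rewrite /mmap1.
rewrite (eq_bigr (fun i => s ^+ m i * h i ^+ m i)) => [|i _]; last exact: exprMn.
by rewrite big_split /= prodrXr mdegE.
Qed.

Lemma eq_mmap (g h : 'I_n -> S) (G : {mpoly K[n]}) :
  g =1 h -> mmap f g G = mmap f h G.
Proof.
move=> gh; apply: eq_bigr => m _; congr (_ * _); apply: eq_bigr => i _.
by rewrite gh.
Qed.

Lemma rmorph_mmap (T : comNzRingType) (f' : {rmorphism K -> T})
    (ev : {rmorphism S -> T}) (h : 'I_n -> S) (G : {mpoly K[n]}) :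
  (forall c, ev (f c) = f' c) -> ev (mmap f h G) = mmap f' (fun i => ev (h i)) G.
Proof.
move=> evf; rewrite /mmap rmorph_sum; apply: eq_bigr => m _.
rewrite rmorphM evf /mmap1 rmorph_prod; congr (_ * _); apply: eq_bigr => i _.
by rewrite rmorphXn.
Qed.

End HomogeneousEvaluation.

Section Evaluation.
Variables (K L : fieldType) (iota : {rmorphism K -> L}).

Definition eval2 (t v : L) : {rmorphism {poly {poly K}} -> L} :=
  horner_eval v \o map_poly (horner_eval t \o map_poly iota).

Lemma eval2C t v a : eval2 t v a%:P = (map_poly iota a).[t].
Proof. by rewrite /eval2 /= map_polyC /= /horner_eval hornerC. Qed.

Lemma eval2CC t v c : eval2 t v c%:P%:P = iota c.
Proof. by rewrite eval2C map_polyC /= hornerC. Qed.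

Lemma eval2X t v : eval2 t v 'X = v.
Proof. by rewrite /eval2 /= map_polyX /horner_eval hornerX. Qed.

Lemma eval2CX t v : eval2 t v 'X%:P = t.
Proof. by rewrite eval2C map_polyX hornerX. Qed.

End Evaluation.

(* A chart of the curve F = 0: the homogeneous coordinates are s times
   polynomials in two functions, the affine coordinates, at which ev
   evaluates.  Those two functions and 1 are conversely the values of the
   linear forms tau, nu and sigma divided by s; in particular the chart is
   the complement of the line sigma = 0. *)
Section Chart.
Variables (K : closedFieldType) (L : fieldType) (iota : {rmorphism K -> L}).
Variables (F : {mpoly K[3]}) (x y : L).
Hypothesis ff : function_field iota F x y.

Local Notation geval := (geval iota x y).
Local Notation coord := (tnth [tuple x; y; 1]).

Variables (e : 'I_3 -> {poly {poly K}}) (s : L).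
Variable ev : {rmorphism {poly {poly K}} -> L}.
Hypothesis evC : forall c, ev c%:P%:P = iota c.

Definition dehomog : {rmorphism {mpoly K[3]} -> {poly {poly K}}} :=
  mmap (polyC \o polyC) e.

Lemma dehomogX i : dehomog 'X_i = e i.
Proof. by rewrite /dehomog /= mmapX mmap1U. Qed.

Lemma dehomogC c : dehomog c%:MP = c%:P%:P.
Proof. exact: mmapC. Qed.

Variables tau nu sigma : {mpoly K[3]}.
Hypothesis nz_s : s != 0.
Hypothesis coord_e : forall i, coord i = s * ev (e i).
Hypothesis tau_homog : tau \is 1.-homog.
Hypothesis nu_homog : nu \is 1.-homog.
Hypothesis sigma_homog : sigma \is 1.-homog.
Hypothesis dehomog_tau : dehomog tau = 'X%:P.
Hypothesis dehomog_nu : dehomog nu = 'X.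
Hypothesis dehomog_sigma : dehomog sigma = 1.
Hypothesis F_monic : dehomog F \is monic.
Hypothesis F_size : (1 < size (dehomog F))%N.

Lemma geval_dehomog n G : G \is n.-homog -> geval G = s ^+ n * ev (dehomog G).
Proof.
move=> homG; rewrite /Defs.geval (eq_mmap _ _ coord_e) (mmap_homogZ _ _ _ homG).
by congr (_ * _); rewrite -(@rmorph_mmap _ _ _ (polyC \o polyC) _ iota ev e G evC).
Qed.

Lemma homogenize Q : exists n G, G \is n.-homog /\ dehomog G = Q.
Proof.
elim/poly2_ind: Q => [c|||Q R [n [G [hG <-]]] [k [H [hH <-]]]|
  Q R [n [G [hG <-]]] [k [H [hH <-]]]].
- exists 0%N, (c%:MP); split; last by rewrite dehomogC.
  exact: dhomogC.
- by exists 1%N, tau.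
- by exists 1%N, nu.
- exists (n + k)%N, (G * sigma ^+ k + sigma ^+ n * H); split.
    by apply: dhomogD; apply: dhomogM => //; rewrite -[X in X.-homog]mul1n dhomogMn.
  by rewrite rmorphD !rmorphM !rmorphXn /= dehomog_sigma !expr1n mulr1 mul1r.
by exists (n + k)%N, (G * H); split; [exact: dhomogM | rewrite rmorphM].
Qed.

Lemma chart_ker Q : ev Q = 0 -> exists S, Q = S * dehomog F.
Proof.
have [n [G [homG <-]]] := homogenize Q => evG0.
have [idealF _] := function_field_ideal ff homG.
have [|R ->] := idealF.
  by rewrite (geval_dehomog homG) evG0 mulr0.
by exists (dehomog R); rewrite rmorphM.
Qed.

Lemma chart_F n : F \is n.-homog -> ev (dehomog F) = 0.
Proof.
move=> homF; have [_ F0] := function_field_ideal ff homF.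
have /eqP := F0 (ex_intro _ 1 (esym (mul1r F))).
by rewrite (geval_dehomog homF) mulf_eq0 expf_eq0 (negPf nz_s) andbF => /eqP.
Qed.

Lemma chart_frac u : exists N H, ev H != 0 /\ ev H * u = ev N.
Proof.
have [n [G [H [homG homH]]]] := function_field_frac ff u.
rewrite (geval_dehomog homG) (geval_dehomog homH) mulf_eq0 => /norP[nz_sn nzH] ->.
exists (dehomog G), (dehomog H); split=> //.
by rewrite -mulf_div divff // mul1r mulrC divfK.
Qed.

Definition chart_point (a b : K) (i : 'I_3) : K := (e i).[b%:P].[a].

Lemma chart_pointE a b G : G.@[chart_point a b] = (dehomog G).[b%:P].[a].
Proof.
rewrite /meval /dehomog.
pose evK : {rmorphism {poly {poly K}} -> K} := horner_eval a \o horner_eval b%:P.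
rewrite -[RHS]/(evK _); apply/esym/rmorph_mmap => c.
by rewrite /= /horner_eval !hornerC.
Qed.

(** The coordinates of a point of the chart are not all zero since sigma takes
    the value 1 there. *)
Lemma chart_on_curve a b :
  (dehomog F).[b%:P].[a] = 0 -> on_curve F (chart_point a b).
Proof.
move=> F0; split; last by rewrite chart_pointE.
apply/existsP; apply: contraT; rewrite negb_exists => /forallP P0.
have : sigma.@[chart_point a b] = 1 by rewrite chart_pointE dehomog_sigma !hornerC.
rewrite /meval (@eq_mmap _ _ _ idfun (chart_point a b) (fun i => 0 * chart_point a b i)).
  by rewrite (mmap_homogZ _ _ _ sigma_homog) mul0r => /esym/eqP; rewrite oner_eq0.
by move=> i; rewrite mul0r; apply/eqP; move: (P0 i); rewrite negbK.
Qed.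

Lemma chart_local a b u : (dehomog F).[b%:P].[a] = 0 ->
    local_ring iota x y (chart_point a b) u ->
  exists N H, H.[b%:P].[a] != 0 /\ ev H * u = ev N.
Proof.
move=> F0 [l [G [H [homG homH + ->]]]]; rewrite chart_pointE => nzH.
exists (dehomog G), (dehomog H); split=> //.
have nzevH : ev (dehomog H) != 0.
  by apply: contraNneq nzH => /chart_ker[S ->]; rewrite !hornerM F0 mulr0.
rewrite (geval_dehomog homG) (geval_dehomog homH) -mulf_div divff ?expf_neq0 //.
by rewrite mul1r mulrC divfK.
Qed.

Section Differentials.
Variables (D : L -> L) (k : nat).
Hypothesis DD : forall u w, D (u + w) = D u + D w.
Hypothesis DM : forall u w, D (u * w) = u * D w + w * D u.
Hypothesis DC : forall c, D (iota c) = 0.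
Hypothesis Dt : exists Q, D (ev 'X%:P) = s ^+ k * ev Q.
Hypothesis Dv : exists Q, D (ev 'X) = s ^+ k * ev Q.

Lemma derivation_chart Q : exists R, D (ev Q) = s ^+ k * ev R.
Proof.
elim/poly2_ind: Q => [c|||Q R [Q' DQ] [R' DR]|Q R [Q' DQ] [R' DR]].
- by exists 0; rewrite evC DC rmorph0 mulr0.
- by [].
- by [].
- by exists (Q' + R'); rewrite !rmorphD DD DQ DR mulrDr.
exists (Q * R' + R * Q').
by rewrite rmorphM DM DQ DR rmorphD !rmorphM mulrDr; ring.
Qed.

Lemma derivation_local a b u N H : H.[b%:P].[a] != 0 -> ev H * u = ev N ->
  exists R H', H'.[b%:P].[a] != 0 /\ ev H' * D u = s ^+ k * ev R.
Proof.
move=> nzHab Du; have [N' DN] := derivation_chart N.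
have [H' DH] := derivation_chart H.
exists (H * N' - N * H'), (H * H); split.
  by rewrite !hornerM mulf_neq0.
have := congr1 D Du; rewrite DM DN DH => E.
rewrite rmorphB !rmorphM /= -Du.
have -> : ev H * ev H * D u = ev H * (ev H * D u + u * (s ^+ k * ev H'))
   - ev H * u * (s ^+ k * ev H') by ring.
rewrite E; ring.
Qed.

(** If the derivatives of the two affine coordinates are s^k times polynomials,
    then so are those of all polynomials, and D maps each local ring of the
    chart into its multiple by s^k.  Hence h w / s^k is regular at every point
    of the chart, and therefore a polynomial. *)
Lemma regular_in_chart (Om : lmodType L) (d : L -> Om)
    (h : {linear Om -> L^o}) n w :
    F \is n.-homog -> (forall u, h (d u) = D u) -> holomorphic iota F x y d w ->
  exists2 Q : {poly {poly K}},
    (size Q < size (dehomog F))%N & h w = s ^+ k * ev Q.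
Proof.
move=> homF hd hol.
suff [Q DQ] : exists Q, h w / s ^+ k = ev Q.
  have [R ltR DR] := ev_small F_monic F_size (chart_F homF) DQ.
  by exists R => //; rewrite -DR mulrC divfK // expf_neq0.
have [N0 [H0 [nzH0 DH0]]] := chart_frac (h w / s ^+ k).
apply: (regular_polynomial F_monic F_size (chart_F homF) chart_ker nzH0 DH0) => a b F0.
have [l [f [g [locf locg ->]]]] := hol _ (chart_on_curve F0).
rewrite raddf_sum /=; elim/big_ind: _ => [|u1 u2 IH1 IH2|i _].
- by exists 0, 1; rewrite mul0r mulr0 rmorph0 !hornerC oner_eq0.
- case: IH1 IH2 => [N [H [nzH E]]] [N' [H' [nzH' E']]].
  exists (H' * N + H * N'), (H * H'); split; first by rewrite !hornerM mulf_neq0.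
  by rewrite rmorphD !rmorphM /= -E -E'; ring.
have [N [H [nzH DN]]] := chart_local F0 (locf i).
have [N' [H' [nzH' DN']]] := chart_local F0 (locg i).
have [R [H'' [nzH'' DR]]] := derivation_local nzH' DN'.
exists (N * R), (H * H''); split; first by rewrite !hornerM mulf_neq0.
rewrite linearZ /= hd !rmorphM /= -DN.
rewrite -[f i *: _]/(f i * D (g i)).
have -> : ev H * ev H'' * (f i * D (g i) / s ^+ k) =
  ev H * f i * ((ev H'' * D (g i)) / s ^+ k) by ring.
by rewrite DR [s ^+ k * _]mulrC mulfK // expf_neq0.
Qed.

End Differentials.
End Chart.

(** * Derivations of the function field *)

Section Derivations.
Variables (K L : fieldType) (iota : {rmorphism K -> L}).
Variables (M : lmodType L) (E : L -> M).
Hypothesis der : derivation iota E.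

Lemma derivation0 : E 0 = 0.
Proof. by rewrite -(rmorph0 iota) (derivationC der). Qed.

Lemma derivation1 : E 1 = 0.
Proof. by rewrite -(rmorph1 iota) (derivationC der). Qed.

Lemma derivationN u : E (- u) = - E u.
Proof. by apply/eqP; rewrite -addr_eq0 -(derivationD der) addNr derivation0. Qed.

Lemma derivationX u n : E (u ^+ n.+1) = (n.+1%:R * u ^+ n) *: E u.
Proof.
elim: n => [|n IHn]; first by rewrite expr1 expr0 mulr1 scale1r.
rewrite exprS (derivationM der) IHn scalerA -scalerDl; congr (_ *: _).
by rewrite -[n.+2]addn1 natrD exprS; move: n.+1%:R => r; ring.
Qed.

Lemma derivationXp p u : p \in [pchar L] -> E (u ^+ p) = 0.
Proof.
move=> charL; have := prime_gt0 (pcharf_prime charL); case: p charL => // p charL _.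
by rewrite derivationX (pcharf0 charL) mul0r scale0r.
Qed.

End Derivations.

Lemma derivation_div (K L : fieldType) (iota : {rmorphism K -> L})
    (D : L -> L^o) u v :
  derivation iota D -> v != 0 -> D (u / v) = (D u * v - u * D v) / v ^+ 2 :> L.
Proof.
move=> der nzv; have := derivationM der v (u / v); rewrite mulrC divfK // => ->.
rewrite -[v *: _]/(v * _) -[_ *: D v]/(_ * D v); field; exact: nzv.
Qed.

Section JacobianDerivation.
Variables (K L : fieldType) (iota : {rmorphism K -> L}).
Variables (F : {mpoly K[3]}) (x y : L).
Hypothesis ff : function_field iota F x y.

Local Notation geval := (geval iota x y).
Local Notation i0 := (Ordinal (isT : (0 < 3)%N)).
Local Notation i1 := (Ordinal (isT : (1 < 3)%N)).
Local Notation i2 := (Ordinal (isT : (2 < 3)%N)).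

HB.instance Definition _ := GRing.RMorphism.copy geval
  (mmap iota (tnth [tuple x; y; 1])).

Lemma gevalX i : geval 'X_i = tnth [tuple x; y; 1] i.
Proof. by rewrite /Defs.geval mmapX mmap1U. Qed.

Lemma gevalC c : geval c%:MP = iota c.
Proof. by rewrite /Defs.geval mmapC. Qed.

Lemma geval_F n : F \is n.-homog -> geval F = 0.
Proof.
by move=> homF; apply/(function_field_ideal ff homF); exists 1; rewrite mul1r.
Qed.

Lemma geval_neq0_on_curve P n (H : {mpoly K[3]}) :
  on_curve F P -> H \is n.-homog -> H.@[P] != 0 -> geval H != 0.
Proof.
move=> [_ FP] homH; apply: contraNneq => /(function_field_ideal ff homH)[Q ->].
by rewrite mevalM FP mulr0.
Qed.

(** This derivation of K[X, Y, Z] kills F and Z, so that it induces one on the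
    affine coordinate ring of the curve. *)
Definition jacobian (G : {mpoly K[3]}) : {mpoly K[3]} :=
  G^`M(i0) * F^`M(i1) - G^`M(i1) * F^`M(i0).

Lemma jacobianM G H : jacobian (G * H) = G * jacobian H + H * jacobian G.
Proof. by rewrite /jacobian !mderivM; ring. Qed.

Lemma jacobianB G H : jacobian (G - H) = jacobian G - jacobian H.
Proof. by rewrite /jacobian !mderivB; ring. Qed.

Lemma jacobianD G H : jacobian (G + H) = jacobian G + jacobian H.
Proof. by rewrite /jacobian !mderivD; ring. Qed.

Lemma jacobianC c : jacobian c%:MP = 0.
Proof. by rewrite /jacobian !mderivC !mul0r subrr. Qed.

Lemma jacobianX i : jacobian 'X_i =
  (i0 == i)%:R * F^`M(i1) - (i1 == i)%:R * F^`M(i0).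
Proof.
by rewrite /jacobian !mderivXU.
Qed.

(** The graph of the induced derivation: w is the derivative of u = G / H
    computed by the product rule from G = u H. *)
Definition jacobian_graph (u w : L) : Prop := exists n G H,
  [/\ G \is n.-homog, H \is n.-homog, geval H != 0, geval G = u * geval H
    & geval (jacobian G) = w * geval H + u * geval (jacobian H)].

Lemma jacobian_graph_total u : exists w, jacobian_graph u w.
Proof.
have [n [G [H [homG homH nzH ->]]]] := function_field_frac ff u.
exists ((geval (jacobian G) - geval G / geval H * geval (jacobian H)) / geval H).
by exists n, G, H; split; rewrite ?divfK //; ring.
Qed.

(** Two fractions G / H = G' / H' satisfy G H' - G' H = Q F, and the Jacobian
    derivation maps Q F to a multiple of F. *)
Lemma jacobian_graph_fun d u w w' : F \is d.-homog ->
  jacobian_graph u w -> jacobian_graph u w' -> w = w'.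
Proof.
move=> homF [n [G [H [homG homH nzH DG JG]]]].
move=> [k [G' [H' [homG' homH' nzH' DG' JG']]]].
have homGH : G * H' - G' * H \is (n + k).-homog.
  by apply: rpredB; last rewrite addnC; exact: dhomogM.
have [+ _] := function_field_ideal ff homGH.
case=> [|Q DQ]; first by rewrite rmorphB !rmorphM /= DG DG'; ring.
have : geval (jacobian (G * H' - G' * H)) = 0.
  rewrite DQ jacobianM rmorphD !rmorphM /= (geval_F homF) mul0r addr0.
  by rewrite [jacobian F]/jacobian [X in X - _]mulrC subrr rmorph0 mulr0.
rewrite jacobianB !jacobianM rmorphB !rmorphD !rmorphM /= JG JG' DG DG'.
have -> (a b c e : L) :
  u * a * e + b * (w * a + u * c) - (u * b * c + a * (w' * b + u * e)) =
    (w - w') * (a * b) by ring.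
by move/eqP; rewrite !mulf_eq0 (negPf nzH) (negPf nzH') !orbF subr_eq0 => /eqP.
Qed.

Lemma jacobian_graphD u v w z : jacobian_graph u w -> jacobian_graph v z ->
  jacobian_graph (u + v) (w + z).
Proof.
move=> [n [G [H [homG homH nzH DG JG]]]].
move=> [k [G' [H' [homG' homH' nzH' DG' JG']]]].
exists (n + k)%N, (G * H' + H * G'), (H * H'); split.
- by apply: rpredD; exact: dhomogM.
- exact: dhomogM.
- by rewrite rmorphM mulf_neq0.
- by rewrite rmorphD !rmorphM /= DG DG'; ring.
rewrite jacobianD !jacobianM !rmorphD !rmorphM /= JG JG' DG DG'; ring.
Qed.

Lemma jacobian_graphM u v w z : jacobian_graph u w -> jacobian_graph v z ->
  jacobian_graph (u * v) (u * z + v * w).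
Proof.
move=> [n [G [H [homG homH nzH DG JG]]]].
move=> [k [G' [H' [homG' homH' nzH' DG' JG']]]].
exists (n + k)%N, (G * G'), (H * H'); split.
- exact: dhomogM.
- exact: dhomogM.
- by rewrite rmorphM mulf_neq0.
- by rewrite !rmorphM /= DG DG'; ring.
rewrite !jacobianM !rmorphD !rmorphM /= JG JG' DG DG'; ring.
Qed.

Lemma jacobian_graphX i : jacobian_graph (geval 'X_i) (geval (jacobian 'X_i)).
Proof.
exists 1%N, 'X_i, 'X_i2; split.
- exact: dhomogXU.
- exact: dhomogXU.
- by rewrite gevalX /= oner_neq0.
- by rewrite (gevalX i2) /= mulr1.
by rewrite (gevalX i2) (jacobianX i2) /= !mul0r subrr rmorph0 mulr0 mulr1 addr0.
Qed.

Lemma jacobian_graphC c : jacobian_graph (iota c) 0.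
Proof.
exists 0%N, c%:MP, 1; split.
- exact: dhomogC.
- exact: dhomog1.
- by rewrite rmorph1 oner_neq0.
- by rewrite rmorph1 mulr1 gevalC.
by rewrite jacobianC rmorph1 -mpolyC1 jacobianC rmorph0 mul0r mulr0 addr0.
Qed.

(** The values at x and y show that D is nonzero when one of the two partial
    derivatives is a nonzero function; the module of differentials of the
    function field is then nonzero as well. *)
Lemma jacobian_derivation d : F \is d.-homog ->
  exists D : L -> L^o, [/\ derivation iota D,
    D x = geval F^`M(i1) & D y = - geval F^`M(i0)].
Proof.
move=> homF.
pose D u : L^o :=
  proj1_sig (constructive_indefinite_description _ (jacobian_graph_total u)).
have DP u : jacobian_graph u (D u).
  by rewrite /D; case: constructive_indefinite_description.
have Dfun u w : jacobian_graph u w -> D u = w by apply: (jacobian_graph_fun homF).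
exists D; split; first split.
- by move=> u v; apply/Dfun/jacobian_graphD.
- by move=> u v; apply/Dfun/jacobian_graphM.
- by move=> c; apply/Dfun/jacobian_graphC.
- have /Dfun := jacobian_graphX i0; rewrite gevalX /= => ->.
  by rewrite jacobianX /= mul1r mul0r subr0.
have /Dfun := jacobian_graphX i1; rewrite gevalX /= => ->.
by rewrite jacobianX /= mul1r mul0r sub0r rmorphN.
Qed.

Lemma derivation_eq0 (M : lmodType L) (E : L -> M) : derivation iota E ->
  E x = 0 -> E y = 0 -> forall u, E u = 0.
Proof.
move=> der Ex Ey u; have E1 := derivation1 der; case: der => ED EM EC.
have EM0 v w : E v = 0 -> E w = 0 -> E (v * w) = 0.
  by move=> Ev Ew; rewrite EM Ev Ew !scaler0 addr0.
have EX v k : E v = 0 -> E (v ^+ k) = 0.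
  by move=> Ev; elim: k => [|k IHk]; rewrite ?expr0 // exprS EM0.
have Ecoord i : E (tnth [tuple x; y; 1] i) = 0.
  by rewrite (tnth_nth 0); case: i => [[|[|[|k]]] lt_i].
have Eg G : E (geval G) = 0.
  elim/mpolyind: G => [|c m G _ _ EG]; first by rewrite rmorph0 -(rmorph0 iota) EC.
  rewrite rmorphD ED EG addr0 /= /Defs.geval mmapZ mmapX.
  apply: (EM0); first exact: EC.
  by rewrite /mmap1; elim/big_ind: _ => [//|a b|i _]; [apply: EM0|apply: EX].
have [n [G [H [_ _ nzH Du]]]] := function_field_frac ff u.
have := Eg G; have -> : geval G = geval H * u by rewrite Du mulrC divfK.
by rewrite EM Eg scaler0 addr0 => /eqP; rewrite scaler_eq0 (negPf nzH) => /eqP.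
Qed.

End JacobianDerivation.

(** * Dimensions and degrees *)

Lemma binomial_neq0 (R : nzRingType) p m i :
  p \in [pchar R] -> (i <= m < p)%N -> 'C(m, i)%:R != 0 :> R.
Proof.
move=> charR /andP[le_im lt_mp]; rewrite -(dvdn_pcharf charR).
have p_prime := pcharf_prime charR.
have : ~~ (p %| m`!)%N.
  elim: m {le_im} lt_mp => [|m IHm] lt_mp.
    by rewrite dvdn1 neq_ltn prime_gt1 ?orbT.
  by rewrite factS Euclid_dvdM // negb_or gtnNdvd //= IHm // ltnW.
by apply: contra => dvd; rewrite -(bin_fact le_im) dvdn_mulr.
Qed.

Lemma has_dim_finType (K L : fieldType) (iota : {rmorphism K -> L}) (M : lmodType L)
    (V : M -> Prop) (T : finType) (A : {pred T}) (b : T -> M) :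
    (forall w, V w <-> exists c : T -> K, w = \sum_(t in A) iota (c t) *: b t) ->
    (forall c : T -> K, \sum_(t in A) iota (c t) *: b t = 0 ->
       {in A, forall t, c t = 0}) ->
  has_dim iota V #|A|.
Proof.
move=> spanV freeb; exists (fun i => b (enum_val i)).
have reindex (c : 'I_#|A| -> K) :
    \sum_i iota (c i) *: b (enum_val i) =
    \sum_(t in A) iota (\sum_(i | enum_val i == t) c i) *: b t.
  rewrite [RHS]big_enum_val; apply: eq_bigr => i _; congr (iota _ *: _).
  rewrite (big_pred1 i) // => k /=; apply/eqP/eqP => [|-> //]; exact: enum_val_inj.
split=> [w | c].
  split=> [/spanV[c ->]|[c ->]]; last by apply/spanV; rewrite reindex; eexists.
  by exists (c \o enum_val); rewrite big_enum_val.
rewrite reindex => /freeb c0 i.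
rewrite -(c0 _ (enum_valP i)) (big_pred1 i) // => k /=.
by apply/eqP/eqP => [|-> //]; exact: enum_val_inj.
Qed.

Lemma card_triangle n :
  #|[pred ij : 'I_n * 'I_n | (ij.1 + ij.2 < n)%N]| = (n * n.+1)./2.
Proof.
rewrite -sum1_card.
rewrite -(pair_big_dep xpredT (fun i j : 'I_n => (i + j < n)%N) (fun _ _ => 1%N)).
rewrite /=.
have col (i : 'I_n) : (\sum_(j < n | i + j < n) 1 = n - i)%N.
  rewrite (eq_bigl (fun j : 'I_n => j < n - i)%N) => [|j]; last by rewrite ltn_subRL.
  by rewrite -(big_ord_widen _ (fun _ => 1%N)) ?leq_subr // sum1_card card_ord.
rewrite (eq_bigr _ (fun i _ => col i)) (reindex_inj rev_ord_inj) /=.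
rewrite (eq_bigr (fun i : 'I_n => i + 1))%N => [|i _]; last by rewrite subKn // addn1.
rewrite big_split /= sum1_card card_ord -(big_mkord xpredT id) triangular_sum.
by rewrite -[X in (_ + X)%N]bin1 -binS bin2 /= mulnC.
Qed.

Lemma eval2_sum (K L : fieldType) (iota : {rmorphism K -> L}) (t v : L) n
    (Q : {poly {poly K}}) : (size Q <= n)%N ->
  eval2 iota t v Q = \sum_(i < n) (map_poly iota Q`_i).[t] * v ^+ i.
Proof.
move=> szQ; rewrite /eval2 /= /horner_eval (@horner_coef_wide _ n).
  by apply: eq_bigr => i _; rewrite coef_map_id0 //= rmorph0 horner0.
by rewrite (leq_trans (size_poly _ _)).
Qed.

(** Uniqueness of the representative of small degree in v, after both sides are
    multiplied by t^N, with N so large that t^(N + k - i) times the i-th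
    coefficient of Q' at 1/t becomes a polynomial in t.  That polynomial has
    degree at most N + k - i, and it is t^N times the i-th coefficient of Q. *)
Lemma two_chart_degree (K L : fieldType) (iota : {rmorphism K -> L}) (t v : L) n k
    (Q Q' : {poly {poly K}}) :
    t != 0 ->
    (forall R : {poly {poly K}},
       (size R <= n)%N -> eval2 iota t v R = 0 -> R = 0) ->
    (size Q <= n)%N -> (size Q' <= n)%N ->
    eval2 iota t v Q = t ^+ k * eval2 iota t^-1 (v / t) Q' ->
  forall i, (size (Q`_i)%R <= k.+1 - i)%N.
Proof.
move=> nzt inj szQ szQ' DQ.
pose N := (n + \max_(i < n) size (Q'`_i)%R)%N.
pose R := \poly_(i < n) \poly_(l < N + k.+1 - i) Q'`_i`_(N + k - i - l).
have RE : R = ('X^N)%:P * Q.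
  apply/eqP; rewrite -subr_eq0; apply/eqP/inj.
    rewrite (leq_trans (size_polyD _ _)) // size_polyN geq_max size_poly /=.
    by rewrite mul_polyC (leq_trans (size_scale_leq _ _)).
  rewrite rmorphB rmorphM eval2C DQ.
  apply/eqP; rewrite subr_eq0 map_polyXn hornerXn; apply/eqP.
  rewrite !(@eval2_sum _ _ _ _ _ n) ?size_poly // !mulr_sumr.
  apply: eq_bigr => i _.
  have lt_iN : (i < N)%N by apply: leq_trans (leq_addr _ _).
  have szQi : (size (Q'`_i)%R <= N + k.+1 - i)%N.
    have := leq_bigmax (F := fun j : 'I_n => size (Q'`_j)%R) i.
    by rewrite /N; have := ltn_ord i; move: (\max_(_ < _) _)%N (size _) => a b; lia.
  rewrite coef_poly ltn_ord (@horner_coef_wide _ (N + k.+1 - i)); last first.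
    by rewrite (leq_trans (size_poly _ _)) // size_poly.
  rewrite (@horner_coef_wide _ (N + k.+1 - i) (map_poly iota Q'`_i)); last first.
    by rewrite (leq_trans (size_poly _ _)).
  rewrite (reindex_inj rev_ord_inj) /= mulr_suml mulr_suml !mulr_sumr.
  apply: eq_bigr => l _; rewrite !coef_map coef_poly /= ifT; last first.
    by have := ltn_ord l; lia.
  have -> : (N + k - i - (N + k.+1 - i - l.+1) = l)%N by have := ltn_ord l; lia.
  rewrite expr_div_n exprVn.
  have -> : t ^+ N * (t ^+ k * (iota Q'`_i`_l / t ^+ l * (v ^+ i / t ^+ i)))
    = iota Q'`_i`_l * (t ^+ (N + k) / t ^+ (l + i)) * v ^+ i.
    by rewrite !exprD invfM; ring.
  have -> : (N + k = (N + k.+1 - i - l.+1) + (l + i))%N by have := ltn_ord l; lia.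
  by rewrite exprD mulfK ?expf_neq0.
move=> i; have [->|nzQi] := eqVneq Q`_i 0; first by rewrite size_poly0.
have lt_in : (i < n)%N.
  by rewrite ltnNge; apply: contra nzQi => le_ni; rewrite nth_default // (leq_trans szQ).
have : (size (R`_i)%R <= N + k.+1 - i)%N by rewrite coef_poly lt_in size_poly.
rewrite RE coefCM mulrC size_mulXn // => le1.
have : (n <= N)%N by apply: leq_addr.
rewrite -size_poly_gt0 in nzQi.
by move: le1 lt_in nzQi; move: (size _) => a; lia.
Qed.

(** * The Pellikaan form and its partial derivatives *)

Section PellikaanForm.
Variable p : nat.

Definition pellikaan_form (A : comNzRingType) (a b c : A) : A :=
  a * b ^+ p.+1 + a ^+ p.+1 * c + b * c ^+ p.+1.

(** In characteristic p this is the partial derivative of the form with respect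
    to its first variable; the other two are obtained by cyclic rotation of
    the variables, which preserves the form. *)
Definition pellikaan_partial (A : comNzRingType) (a b c : A) : A :=
  b ^+ p.+1 + a ^+ p * c.

Lemma rmorph_pellikaan_form (A B : comNzRingType) (f : {rmorphism A -> B}) a b c :
  f (pellikaan_form a b c) = pellikaan_form (f a) (f b) (f c).
Proof. by rewrite !rmorphD !rmorphM !rmorphXn. Qed.

Lemma rmorph_pellikaan_partial (A B : comNzRingType) (f : {rmorphism A -> B}) a b c :
  f (pellikaan_partial a b c) = pellikaan_partial (f a) (f b) (f c).
Proof. by rewrite !rmorphD !rmorphM !rmorphXn. Qed.

Lemma pellikaan_form_euler (A : comNzRingType) (a b c : A) :
  a * pellikaan_partial a b c + b * pellikaan_partial b c a
    + c * pellikaan_partial c a b = pellikaan_form a b c *+ 2.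
Proof. by rewrite /pellikaan_partial /pellikaan_form !exprS; ring. Qed.

Lemma derivation_pellikaan_form (A : comNzRingType) (D : A -> A) (a b c : A) :
    p%:R = 0 :> A -> {morph D : u v / u + v} ->
    (forall u v, D (u * v) = D u * v + u * D v) ->
  D (pellikaan_form a b c) =
    D a * pellikaan_partial a b c + D b * pellikaan_partial b c a
      + D c * pellikaan_partial c a b.
Proof.
move=> p0 DD DM.
have DX u n : D (u ^+ n.+1) = n.+1%:R * (D u * u ^+ n).
  elim: n => [|n IHn]; first by rewrite expr1 expr0 mulr1 mul1r.
  rewrite exprS DM IHn -[n.+2]addn1 natrD !exprS.
  by move: n.+1%:R (u ^+ n) => r w; ring.
have DXp u : D (u ^+ p.+1) = D u * u ^+ p.
  by rewrite DX -addn1 natrD p0 add0r mul1r.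
rewrite /pellikaan_form !DD !DM !DXp /pellikaan_partial; ring.
Qed.

End PellikaanForm.

(** Smoothness of the curve, in the form needed to find a local parameter at a
    point: if the partial derivatives with respect to a and b vanished, then
    b c^(p+1) = form - a (partial in a) would be 0, so b = 0, then a = 0, and
    the partial derivative in b would be c^(p+1). *)
Lemma pellikaan_smooth (p : nat) (K : fieldType) (a b c : K) :
    c != 0 -> pellikaan_form p a b c = 0 ->
  pellikaan_partial p a b c != 0 \/ pellikaan_partial p b c a != 0.
Proof.
move=> nzc F0; have [Fa0|] := eqVneq (pellikaan_partial p a b c) 0; last by left.
right; apply/eqP => Fb0.
have cb : b * c ^+ p.+1 = 0.
  have -> : b * c ^+ p.+1 = pellikaan_form p a b c - a * pellikaan_partial p a b c.
    by rewrite /pellikaan_form /pellikaan_partial [a ^+ p.+1]exprS; ring.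
  by rewrite F0 Fa0 mulr0 subr0.
have b0 : b = 0.
  by move/eqP: cb; rewrite mulf_eq0 expf_eq0 (negPf nzc) andbF orbF => /eqP.
have a0 : a = 0.
  move/eqP: F0; rewrite /pellikaan_form b0 exprS !mul0r mulr0 add0r addr0.
  by rewrite mulf_eq0 (negPf nzc) orbF expf_eq0 => /eqP.
move/eqP: Fb0.
by rewrite /pellikaan_partial a0 mulr0 addr0 expf_eq0 (negPf nzc) andbF.
Qed.

Section PellikaanCurve.
Variables (p : nat) (p_prime : prime p) (K : closedFieldType).
Hypothesis charK : p \in [pchar K].

Local Notation i0 := (Ordinal (isT : (0 < 3)%N)).
Local Notation i1 := (Ordinal (isT : (1 < 3)%N)).
Local Notation i2 := (Ordinal (isT : (2 < 3)%N)).
Local Notation X := ('X_i0 : {mpoly K[3]}).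
Local Notation Y := ('X_i1 : {mpoly K[3]}).
Local Notation Z := ('X_i2 : {mpoly K[3]}).
Local Notation F := (pellikaan p K).

Lemma pellikaan_homog : F \is p.+2.-homog.
Proof.
rewrite /pellikaan !rpredD //.
- exact: dhomogM_eq (add1n _) (dhomogXU _ _) (dhomogXUn _ _ _).
- exact: dhomogM_eq (addn1 _) (dhomogXUn _ _ _) (dhomogXU _ _).
exact: dhomogM_eq (add1n _) (dhomogXU _ _) (dhomogXUn _ _ _).
Qed.

Local Notation FX := (pellikaan_partial p X Y Z).
Local Notation FY := (pellikaan_partial p Y Z X).
Local Notation FZ := (pellikaan_partial p Z X Y).

Lemma pellikaan_partial_homog (i k l : 'I_3) :
  pellikaan_partial p ('X_i : {mpoly K[3]}) 'X_k 'X_l \is p.+1.-homog.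
Proof.
rewrite rpredD ?dhomogXUn //.
exact: dhomogM_eq (addn1 _) (dhomogXUn _ _ _) (dhomogXU _ _).
Qed.

Lemma mderiv_pellikaan : F^`M(i0) = FX /\ F^`M(i1) = FY.
Proof.
have p0 : p%:R = 0 :> {mpoly K[3]}.
  by rewrite -[p%:R](rmorph_nat (@mpolyC 3 K)) (pcharf0 charK) rmorph0.
have dF i : F^`M(i) = _ :=
  derivation_pellikaan_form X Y Z p0 (mderivD i) (mderivM i).
by rewrite !dF !mderivXU /= !mul0r !mul1r ?addr0 ?add0r.
Qed.

Section Charts.
Variable e : 'I_3 -> {poly {poly K}}.

Lemma dehomog_pellikaan : dehomog e F = pellikaan_form p (e i0) (e i1) (e i2).
Proof.
by rewrite [LHS](rmorph_pellikaan_form p (dehomog e) X Y Z) !dehomogX.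
Qed.

(** The term of highest degree comes from Y Z^(p+1), as Z is the difference of
    the second affine coordinate and of c. *)
Lemma monic_pellikaan c : e i1 = 'X -> e i2 = 'X - c%:P ->
    (size (e i0 * e i1 ^+ p.+1 + e i0 ^+ p.+1 * e i2)%R <= p.+2)%N ->
  dehomog e F \is monic /\ size (dehomog e F) = p.+3.
Proof.
rewrite dehomog_pellikaan /pellikaan_form => -> -> sz_lo.
have mon : 'X * ('X - c%:P) ^+ p.+1 \is monic.
  by rewrite monicMl ?monicX // monic_exp ?monicXsubC.
have sz : size ('X * ('X - c%:P) ^+ p.+1) = p.+3.
  rewrite size_monicM ?monicX ?monic_neq0 ?monic_exp ?monicXsubC //.
  by rewrite size_polyX size_exp_XsubC.
split; last by rewrite addrC size_polyDl // sz ltnS.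
by rewrite monicE lead_coefDr ?(monicP mon) // sz ltnS.
Qed.

End Charts.

(** The chart Y <> Z, with coordinates X / (Y - Z) and Y / (Y - Z). *)
Definition affine_chart : 'I_3 -> {poly {poly K}} :=
  tnth [tuple 'X%:P; 'X; 'X - 1%:P].

(** The chart X <> 0, with coordinates (Y - Z) / X and Y / X. *)
Definition infinite_chart : 'I_3 -> {poly {poly K}} :=
  tnth [tuple 1; 'X; 'X - 'X%:P].

Lemma affine_chart_monic :
  dehomog affine_chart F \is monic /\ size (dehomog affine_chart F) = p.+3.
Proof.
apply: (monic_pellikaan (c := 1)) => //.
rewrite (leq_trans (size_polyD _ _)) // geq_max /affine_chart !(tnth_nth 0) /=.
rewrite mul_polyC (leq_trans (size_scale_leq _ _)) ?size_polyXn //.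
by rewrite -rmorphXn /= mul_polyC (leq_trans (size_scale_leq _ _)) // size_XsubC.
Qed.

Lemma infinite_chart_monic :
  dehomog infinite_chart F \is monic /\ size (dehomog infinite_chart F) = p.+3.
Proof.
apply: (monic_pellikaan (c := 'X)) => //.
rewrite (leq_trans (size_polyD _ _)) // geq_max /infinite_chart !(tnth_nth 0) /=.
by rewrite mul1r size_polyXn leqnn expr1n mul1r size_XsubC.
Qed.

Lemma dhomogYZ : Y - Z \is 1.-homog.
Proof. by rewrite rpredB ?dhomogXU. Qed.

Lemma affine_chart_forms : [/\ dehomog affine_chart X = 'X%:P,
  dehomog affine_chart Y = 'X & dehomog affine_chart (Y - Z) = 1].
Proof.
by rewrite rmorphB !dehomogX /affine_chart !(tnth_nth 0) /= opprB addrC subrK.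
Qed.

Lemma infinite_chart_forms : [/\ dehomog infinite_chart (Y - Z) = 'X%:P,
  dehomog infinite_chart Y = 'X & dehomog infinite_chart X = 1].
Proof.
by rewrite rmorphB !dehomogX /infinite_chart !(tnth_nth 0) /= opprB addrC subrK.
Qed.

(** * Holomorphic differentials *)

Section FunctionField.
Variables (L : fieldType) (iota : {rmorphism K -> L}) (x y : L).
Hypothesis ff : function_field iota F x y.
Local Notation geval := (geval iota x y).

Local Notation fx := (pellikaan_partial p x y 1).
Local Notation fy := (pellikaan_partial p y 1 x).
Local Notation fz := (pellikaan_partial p 1 x y).

Lemma charL : p \in [pchar L].
Proof. by rewrite (fmorph_pchar iota). Qed.

Lemma gevalXYZ : [/\ geval X = x, geval Y = y & geval Z = 1].
Proof. by rewrite !gevalX. Qed.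

Lemma geval_partial i k l : geval (pellikaan_partial p 'X_i 'X_k 'X_l) =
  pellikaan_partial p (geval 'X_i) (geval 'X_k) (geval 'X_l).
Proof. exact: (rmorph_pellikaan_partial p (mmap iota (tnth [tuple x; y; 1]))). Qed.

Lemma pellikaan_eq : x * y ^+ p.+1 + x ^+ p.+1 + y = 0.
Proof.
have <- : geval F = 0 by apply: (geval_F ff pellikaan_homog).
have -> : geval F = pellikaan_form p (geval X) (geval Y) (geval Z).
  exact: (rmorph_pellikaan_form p (mmap iota (tnth [tuple x; y; 1]))).
by rewrite !gevalX /pellikaan_form !(tnth_nth 0) /= expr1n !mulr1.
Qed.

Lemma geval_eq0_small e n G : G \is n.-homog ->
    (size (dehomog e G) < size (dehomog e F))%N -> geval G = 0 ->
  dehomog e G = 0.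
Proof.
move=> homG ltG /(function_field_ideal ff homG)[Q DG].
move: ltG; rewrite DG rmorphM; have [-> | nzQ] := eqVneq (dehomog e Q) 0.
  by rewrite mul0r.
have [-> | nzF] := eqVneq (dehomog e F) 0; first by rewrite mulr0.
rewrite size_mul //; move: nzQ nzF; rewrite -!size_poly_gt0.
by move: (size _) (size _) => a b; clear; lia.
Qed.

Lemma x_neq0 : x != 0.
Proof.
have [_ szF] := infinite_chart_monic.
have [_ _ dX] := infinite_chart_forms.
apply/eqP => x0.
suff /eqP : dehomog infinite_chart X = 0 by rewrite dX oner_eq0.
by apply: (geval_eq0_small (dhomogXU K i0)); rewrite ?gevalX // dX size_poly1 szF.
Qed.

Lemma ym1_neq0 : y - 1 != 0.
Proof.
have [_ szF] := affine_chart_monic.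
have [_ _ dYZ] := affine_chart_forms.
apply/eqP => y1.
suff /eqP : dehomog affine_chart (Y - Z) = 0 by rewrite dYZ oner_eq0.
apply: (geval_eq0_small dhomogYZ).
  by rewrite dYZ size_poly1 szF.
by rewrite rmorphB /= !gevalX.
Qed.

Lemma fy_neq0 : fy != 0.
Proof.
apply/eqP => fy0; have := pellikaan_eq.
move/eqP: fy0; rewrite /pellikaan_partial expr1n addr_eq0 => /eqP E.
have -> : x * y ^+ p.+1 + x ^+ p.+1 + y = x ^+ p.+1 + y * (1 + y ^+ p * x).
  by rewrite [y ^+ p.+1]exprS; ring.
rewrite E addNr mulr0 addr0 => /eqP; rewrite expf_eq0 /= => x0.
by have := x_neq0; rewrite x0.
Qed.

Lemma partials_euler : x * fx + y * fy + fz = 0.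
Proof.
have := pellikaan_form_euler p x y 1; rewrite mul1r => ->.
by rewrite /pellikaan_form expr1n !mulr1 pellikaan_eq mul0rn.
Qed.

Variables (Om : lmodType L) (d : L -> Om).
Hypothesis d_der : derivation iota d.
(* The derivation D is the Jacobian one, and h is the linear form on the
   differentials that corresponds to it. *)
Variables (D : L -> L^o) (h : {linear Om -> L^o}).
Hypothesis D_der : derivation iota D.
Hypothesis Dx : D x = fy.
Hypothesis Dy : D y = - fx.
Hypothesis hd : forall u, D u = h (d u).

Let nz_x : x != 0 := x_neq0.
Let nz_fy : fy != 0 := fy_neq0.

Definition base_form : Om := fy^-1 *: d x.
Local Notation omega := base_form.

Lemma h_scale u w : (h (u *: w) : L) = u * (h w : L).
Proof. by rewrite [LHS]linearZ. Qed.

Lemma h_base_form : h omega = 1.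
Proof. by rewrite linearZ /= -hd Dx; apply: mulVf. Qed.

(** Differentiate y fy = - x^(p+1), where d fy = y^p dx because y^p has
    derivative 0. *)
Lemma dyE : d y = - fx *: omega.
Proof.
have Ey : y * fy = - x ^+ p.+1.
  apply/eqP; rewrite -addr_eq0; apply/eqP; rewrite -pellikaan_eq.
  by rewrite /pellikaan_partial expr1n [y ^+ p.+1]exprS; ring.
have := congr1 d Ey.
have dfy : d fy = y ^+ p *: d x.
  rewrite /pellikaan_partial expr1n (derivationD d_der) (derivation1 d_der) add0r.
  by rewrite (derivationM d_der) (derivationXp d_der _ charL) scaler0 addr0.
rewrite (derivationN d_der) (derivationX d_der) (derivationM d_der) dfy.
rewrite -[p.+1]addn1 natrD (pcharf0 charL) add0r mul1r scalerA.
rewrite scalerA => E.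
have {}E : fy *: d y = - fx *: d x.
  have -> : fx = y * y ^+ p + x ^+ p by rewrite /pellikaan_partial mulr1 exprS.
  by rewrite scaleNr [X in _ = - X]scalerDl opprD -E addrA addNr add0r.
have -> : d y = fy^-1 *: (fy *: d y) by rewrite scalerA mulVf // scale1r.
by rewrite E /base_form !scalerA [_ * (- fx)]mulrC.
Qed.

Lemma baseD u v : (D (u + v) : L) = (D u : L) + (D v : L).
Proof. exact: (derivationD D_der). Qed.

Lemma baseM u v : (D (u * v) : L) = u * (D v : L) + v * (D u : L).
Proof. exact: (derivationM D_der). Qed.

Lemma d_base_form u : d u = (D u : L) *: omega.
Proof.
pose E u := d u - (D u : L) *: omega.
have der : derivation iota E.
  split=> [a b|a b|c]; rewrite /E.
  - by rewrite (derivationD d_der) baseD scalerDl opprD addrACA.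
  - by rewrite (derivationM d_der) baseM !scalerBr scalerDl opprD addrACA !scalerA.
  by rewrite (derivationC d_der) (derivationC D_der) scale0r subrr.
apply/eqP; rewrite -subr_eq0 -/(E u); apply/eqP/(derivation_eq0 ff der).
  by rewrite /E Dx /base_form scalerA divff // scale1r subrr.
by rewrite /E Dy dyE subrr.
Qed.

(** Here H is, up to sign, the partial derivative of F in the variable other
    than X_i and X_k; where it does not vanish, X_i / X_k is a local parameter,
    and G omega = (G X_k^2 / H) d (X_i / X_k). *)
Lemma regular_chart P (G H : {mpoly K[3]}) i k : on_curve F P ->
    G \is p.-1.-homog -> H \is p.+1.-homog -> H.@[P] != 0 -> P k != 0 ->
    D (geval 'X_i) * geval 'X_k - geval 'X_i * D (geval 'X_k) = geval H ->
  regular_at iota x y d P (geval G *: omega).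
Proof.
move=> onP homG homH nzH nzPk DE.
have nzk : geval 'X_k != 0.
  by apply: (geval_neq0_on_curve ff onP (dhomogXU K k)); rewrite mevalXU.
have nzgH := geval_neq0_on_curve ff onP homH nzH.
exists 1%N, (fun=> geval (G * 'X_k ^+ 2) / geval H).
exists (fun=> geval 'X_i / geval 'X_k); split.
- move=> _; exists p.+1, (G * 'X_k ^+ 2), H; split=> //.
  apply: dhomogM_eq homG (dhomogXUn K k 2).
  by rewrite addn2 prednK // prime_gt0.
- move=> _; exists 1%N, 'X_i, 'X_k; split; rewrite ?dhomogXU //.
  by rewrite mevalXU.
rewrite big_ord1 d_base_form (derivation_div _ D_der nzk) DE scalerA.
congr (_ *: _); rewrite rmorphM rmorphXn /=; move: nzk nzgH.
move: (geval _) (geval _) (geval _) => a b c.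
by move=> nza nzb; field; rewrite nza nzb.
Qed.

(** For a point with nonzero k-th coordinate, pellikaan_smooth provides the
    partial derivative required by regular_chart. *)
Lemma holomorphic_geval G : G \is p.-1.-homog ->
  holomorphic iota F x y d (geval G *: omega).
Proof.
move=> homG P onP; have [[k nzPk] FP] := onP.
have [gX gY gZ] := gevalXYZ.
have eul := partials_euler.
have D1 : D 1 = 0 := derivation1 D_der.
have evP i l m : (pellikaan_partial p ('X_i : {mpoly K[3]}) 'X_l 'X_m).@[P] =
    pellikaan_partial p (P i) (P l) (P m).
  by rewrite [LHS](rmorph_pellikaan_partial p (meval P)) /= !mevalXU.
have gev i l m : geval (pellikaan_partial p 'X_i 'X_l 'X_m) =
    pellikaan_partial p (geval 'X_i) (geval 'X_l) (geval 'X_m).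
  exact: geval_partial.
have {FP} F0 : pellikaan_form p (P i0) (P i1) (P i2) = 0.
  by rewrite -FP [RHS](rmorph_pellikaan_form p (meval P)) /= !mevalXU.
have form_rot (a b c : K) : pellikaan_form p b c a = pellikaan_form p a b c.
  by rewrite /pellikaan_form; ring.
have reg i k H := @regular_chart P G H i k onP homG.
have hom i l m := pellikaan_partial_homog i l m.
have homN i l m :
    - pellikaan_partial p ('X_i : {mpoly K[3]}) 'X_l 'X_m \is p.+1.-homog.
  by rewrite rpredN hom.
case: k nzPk => [[|[|[|//]]] lt_k]; rewrite (bool_irrelevance lt_k isT) => nzPk.
- have F0' : pellikaan_form p (P i1) (P i2) (P i0) = 0 by rewrite form_rot.
  case: (pellikaan_smooth nzPk F0') => nzF.
    apply: (reg i2 i0 (- FY) (homN _ _ _)) => //.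
      by rewrite mevalN oppr_eq0 evP.
    by rewrite rmorphN /= gev gX gY gZ D1 Dx; ring.
  apply: (reg i1 i0 FZ (hom _ _ _)) => //; first by rewrite evP.
  rewrite gev gX gY gZ Dx Dy -[RHS]subr0 -eul; ring.
- have F0' : pellikaan_form p (P i2) (P i0) (P i1) = 0 by rewrite -form_rot.
  case: (pellikaan_smooth nzPk F0') => nzF.
    apply: (reg i0 i1 (- FZ) (homN _ _ _)) => //.
      by rewrite mevalN oppr_eq0 evP.
    rewrite rmorphN /= gev gX gY gZ Dx Dy -[RHS]addr0 -eul; ring.
  apply: (reg i2 i1 FX (hom _ _ _)) => //; first by rewrite evP.
  by rewrite gev gX gY gZ D1 Dy; ring.
case: (pellikaan_smooth nzPk F0) => nzF.
  apply: (reg i1 i2 (- FX) (homN _ _ _)) => //.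
      by rewrite mevalN oppr_eq0 evP.
  by rewrite rmorphN /= gev gX gY gZ D1 Dy; ring.
apply: (reg i0 i2 FY (hom _ _ _)) => //; first by rewrite evP.
by rewrite gev gX gY gZ D1 Dx; ring.
Qed.

Definition low_degree : {pred 'I_p * 'I_p} :=
  [pred ij : 'I_p * 'I_p | (ij.1 + ij.2 < p)%N].

Definition monomial (ij : 'I_p * 'I_p) : L := x ^+ ij.1 * y ^+ ij.2.

Definition low_degree_span (u : L) : Prop :=
  exists c : 'I_p * 'I_p -> K,
    u = \sum_(ij in low_degree) iota (c ij) * monomial ij.

Lemma span0 : low_degree_span 0.
Proof. by exists (fun=> 0); rewrite big1 // => ij _; rewrite rmorph0 mul0r. Qed.

Lemma spanD u v : low_degree_span u -> low_degree_span v -> low_degree_span (u + v).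
Proof.
move=> [b ->] [c ->]; exists (fun ij => b ij + c ij); rewrite -big_split.
by apply: eq_bigr => ij _; rewrite rmorphD mulrDl.
Qed.

Lemma spanZ c u : low_degree_span u -> low_degree_span (iota c * u).
Proof.
move=> [b ->]; exists (fun ij => c * b ij); rewrite mulr_sumr.
by apply: eq_bigr => ij _; rewrite rmorphM mulrA.
Qed.

Lemma spanN u : low_degree_span u -> low_degree_span (- u).
Proof. by move=> /(spanZ (-1)); rewrite rmorphN1 mulN1r. Qed.

Lemma span_monomial i j : (i + j < p)%N -> low_degree_span (x ^+ i * y ^+ j).
Proof.
move=> lt_ij; have lt_i : (i < p)%N by apply: leq_ltn_trans lt_ij; rewrite leq_addr.
have lt_j : (j < p)%N by apply: leq_ltn_trans lt_ij; rewrite leq_addl.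
exists (fun kl => (kl == (Ordinal lt_i, Ordinal lt_j))%:R).
rewrite (bigD1 (Ordinal lt_i, Ordinal lt_j)) //= eqxx rmorph1 mul1r big1 ?addr0 //.
by move=> kl /andP[_ /negPf->]; rewrite rmorph0 mul0r.
Qed.

Lemma span_shifted i j k : (i + j + k < p)%N ->
  low_degree_span (x ^+ i * y ^+ j * (y - 1) ^+ k).
Proof.
elim: k j => [|k IHk] j lt_ijk.
  by rewrite expr0 mulr1; apply: span_monomial; rewrite addn0 in lt_ijk.
have -> : x ^+ i * y ^+ j * (y - 1) ^+ k.+1 =
    x ^+ i * y ^+ j.+1 * (y - 1) ^+ k - x ^+ i * y ^+ j * (y - 1) ^+ k.
  by rewrite !exprS; ring.
by apply: spanD; [|apply: spanN]; apply: IHk; move: lt_ijk; clear; lia.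
Qed.

Lemma base_div u v : v != 0 ->
  (D (u / v) : L) = ((D u : L) * v - u * (D v : L)) / v ^+ 2.
Proof. exact: (derivation_div u D_der). Qed.

Lemma base1 : (D 1 : L) = 0.
Proof. exact: (derivation1 D_der). Qed.

Lemma base_sub1 u : (D (u - 1) : L) = D u.
Proof. by rewrite baseD (derivationN D_der) base1 oppr0 addr0. Qed.

Let ev_aff := eval2 iota (x / (y - 1)) (y / (y - 1)).
Let ev_inf := eval2 iota ((y - 1) / x) (y / x).

Lemma affine_coord i : tnth [tuple x; y; 1] i = (y - 1) * ev_aff (affine_chart i).
Proof.
have : ev_aff 'X = y / (y - 1) by apply: eval2X.
have : ev_aff 'X%:P = x / (y - 1) by apply: eval2CX.
have nz := ym1_neq0.
move: ev_aff => ev evX evY; rewrite /affine_chart !(tnth_nth 0).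
case: i => [[|[|[|//]]] lt_i] /=.
- by rewrite evX mulrC divfK.
- by rewrite evY mulrC divfK.
rewrite rmorphB polyC1 rmorph1 evY mulrBr mulr1 [_ * (y / _)]mulrC divfK //.
by rewrite opprB addrC subrK.
Qed.

Lemma infinite_coord i : tnth [tuple x; y; 1] i = x * ev_inf (infinite_chart i).
Proof.
have : ev_inf 'X = y / x by apply: eval2X.
have : ev_inf 'X%:P = (y - 1) / x by apply: eval2CX.
move: ev_inf => ev evX evY; rewrite /infinite_chart !(tnth_nth 0).
case: i => [[|[|[|//]]] lt_i] /=.
- by rewrite rmorph1 mulr1.
- by rewrite evY mulrC divfK.
by rewrite rmorphB evX evY -mulrBl opprB addrC subrK mulrC divfK.
Qed.

(** The derivatives of the chart coordinates are combinations of the partial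
    derivatives of F, divided by s^2; those have degree p + 1, which leaves
    the exponent p - 1. *)
Lemma form_in_chart s e (ev : {rmorphism {poly {poly K}} -> L}) G u :
    (forall c, ev c%:P%:P = iota c) ->
    (forall i, tnth [tuple x; y; 1] i = s * ev (e i)) -> s != 0 ->
    G \is p.+1.-homog -> u = geval G / s ^+ 2 ->
  exists Q, u = s ^+ p.-1 * ev Q.
Proof.
move=> evC evE nzs homG ->; exists (dehomog e G).
rewrite (geval_dehomog evC evE homG).
have -> : p.+1 = (p.-1 + 2)%N by rewrite addn2 prednK // prime_gt0.
by rewrite exprD [_ * _ * ev _]mulrAC mulfK ?expf_neq0.
Qed.

Lemma gevalFXYZ : [/\ geval FX = fx, geval FY = fy & geval FZ = fz].
Proof. by rewrite !geval_partial !gevalX. Qed.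

Lemma affine_holomorphic w : holomorphic iota F x y d w ->
  exists2 Q : {poly {poly K}},
    (size Q <= p.+2)%N & h w = (y - 1) ^+ p.-1 * ev_aff Q.
Proof.
have [monF szF] := affine_chart_monic.
have [gX gY gZ] := gevalFXYZ.
have evC c : ev_aff c%:P%:P = iota c by apply: eval2CC.
have nz := ym1_neq0.
have eul := partials_euler.
have inF Q : Q \is p.+1.-homog ->
    exists R, geval Q / (y - 1) ^+ 2 = (y - 1) ^+ p.-1 * ev_aff R.
  by move=> homQ; apply: (form_in_chart evC affine_coord nz homQ).
have [dX dY dYZ] := affine_chart_forms.
have Dt : exists Q, (D (ev_aff 'X%:P) : L) = (y - 1) ^+ p.-1 * ev_aff Q.
  rewrite eval2CX base_div // base_sub1 Dx Dy.
  have -> : fy * (y - 1) - x * - fx = geval (- (FY + FZ)).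
    by rewrite rmorphN rmorphD /= gY gZ -[RHS]addr0 -eul; ring.
  by apply: inF; rewrite rpredN rpredD // pellikaan_partial_homog.
have Dv : exists Q, (D (ev_aff 'X) : L) = (y - 1) ^+ p.-1 * ev_aff Q.
  rewrite eval2X base_div // base_sub1 Dy.
  have -> : - fx * (y - 1) - y * - fx = geval FX by rewrite gX; ring.
  exact/inF/pellikaan_partial_homog.
have szF1 : (1 < size (dehomog affine_chart F))%N by rewrite szF.
move=> hol; have [Q szQ ->] := regular_in_chart ff evC nz affine_coord (dhomogXU K i0)
  (dhomogXU K i1) dhomogYZ dX dY dYZ monF szF1 baseD baseM (derivationC D_der) Dt Dv
  pellikaan_homog (fun u => esym (hd u)) hol.
by exists Q => //; rewrite -ltnS -szF.
Qed.

Lemma infinite_holomorphic w : holomorphic iota F x y d w ->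
  exists2 Q : {poly {poly K}},
    (size Q <= p.+2)%N & h w = x ^+ p.-1 * ev_inf Q.
Proof.
have [monF szF] := infinite_chart_monic.
have [gX gY gZ] := gevalFXYZ.
have evC c : ev_inf c%:P%:P = iota c by apply: eval2CC.
have eul := partials_euler.
have inF Q : Q \is p.+1.-homog ->
    exists R, geval Q / x ^+ 2 = x ^+ p.-1 * ev_inf R.
  by move=> homQ; apply: (form_in_chart evC infinite_coord nz_x homQ).
have [dYZ dY dX] := infinite_chart_forms.
have Dt : exists Q, (D (ev_inf 'X%:P) : L) = x ^+ p.-1 * ev_inf Q.
  rewrite eval2CX base_div // base_sub1 Dx Dy.
  have -> : - fx * x - (y - 1) * fy = geval (FY + FZ).
    by rewrite rmorphD /= gY gZ -[RHS]subr0 -eul; ring.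
  by apply: inF; rewrite rpredD // pellikaan_partial_homog.
have Dv : exists Q, (D (ev_inf 'X) : L) = x ^+ p.-1 * ev_inf Q.
  rewrite eval2X base_div // Dx Dy.
  have -> : - fx * x - y * fy = geval FZ by rewrite gZ -[RHS]subr0 -eul; ring.
  exact/inF/pellikaan_partial_homog.
have szF1 : (1 < size (dehomog infinite_chart F))%N by rewrite szF.
move=> hol; have [Q szQ ->] := regular_in_chart ff evC nz_x infinite_coord dhomogYZ
  (dhomogXU K i1) (dhomogXU K i0) dYZ dY dX monF szF1 baseD baseM (derivationC D_der) Dt Dv
  pellikaan_homog (fun u => esym (hd u)) hol.
by exists Q => //; rewrite -ltnS -szF.
Qed.

(** With t = x / (y - 1), the coordinates of the second chart are 1 / t and
    v / t, and its denominator x is t (y - 1); so two_chart_degree applies with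
    k = p - 1. *)
Lemma holomorphic_span w : holomorphic iota F x y d w -> low_degree_span (h w).
Proof.
move=> hol; have [Q szQ DQ] := affine_holomorphic hol.
have [Q' szQ' DQ'] := infinite_holomorphic hol.
have nz := ym1_neq0.
have deg i : (size (Q`_i)%R <= p - i)%N.
  rewrite -[X in (X - i)%N](prednK (prime_gt0 p_prime)).
  apply: (two_chart_degree _ _ szQ szQ' (iota := iota)
    (t := x / (y - 1)) (v := y / (y - 1))).
  - by rewrite mulf_neq0 ?invr_eq0.
  - move=> R szR; have [monF szF] := affine_chart_monic.
    have [dX dY dYZ] := affine_chart_forms.
    apply: (ev_eq0_small monF); rewrite ?szF ?ltnS //.
    exact: (chart_ker ff (eval2CC iota _ _) affine_coord (dhomogXU K i0)
      (dhomogXU K i1) dhomogYZ dX dY dYZ).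
  rewrite invf_div.
  have -> : y / (y - 1) * ((y - 1) / x) = y / x by rewrite mulrA divfK.
  have := DQ'; rewrite DQ => E.
  apply: (mulfI (expf_neq0 p.-1 nz)); rewrite [LHS]E expr_div_n mulrA.
  by rewrite [_ * (_ / _)]mulrC divfK ?expf_neq0.
rewrite DQ (eval2_sum _ _ _ szQ) mulr_sumr.
elim/big_ind: _ => [||i _]; [exact: span0|exact: spanD|].
rewrite (@horner_coef_wide _ (p - i)); last by rewrite (leq_trans (size_poly _ _)).
rewrite mulr_suml mulr_sumr.
elim/big_ind: _ => [||l _]; [exact: span0|exact: spanD|].
rewrite coef_map.
have lt_il : (l + i < p)%N by have := ltn_ord l; clear; lia.
have -> : (y - 1) ^+ p.-1 *
    (iota Q`_i`_l * (x / (y - 1)) ^+ l * (y / (y - 1)) ^+ i) =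
    iota Q`_i`_l * (x ^+ l * y ^+ i * (y - 1) ^+ (p.-1 - (l + i))).
  have -> : (p.-1 = (p.-1 - (l + i)) + l + i)%N by move: lt_il; clear; lia.
  rewrite -[(_ + l + i)%N]addnA addnK.
  rewrite !exprD !expr_div_n.
  move: (expf_neq0 l nz) (expf_neq0 i nz).
  move: ((y - 1) ^+ l) ((y - 1) ^+ i) => a b nza nzb.
  by field; rewrite nza nzb.
by apply/spanZ/span_shifted; move: lt_il; clear; lia.
Qed.

Lemma origin_on_curve : on_curve F (fun i => (i == i2)%:R).
Proof.
split; first by exists i2; rewrite eqxx oner_neq0.
rewrite [LHS](rmorph_pellikaan_form p (meval _)) /= !mevalXU.
by rewrite /pellikaan_form !expr0n !mul0r !addr0.
Qed.

Lemma holomorphic_base_form w : holomorphic iota F x y d w -> w = (h w : L) *: omega.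
Proof.
move=> /(_ _ origin_on_curve)[n [a [b [_ _ ->]]]].
rewrite linear_sum /= scaler_suml; apply: eq_bigr => i _.
by rewrite h_scale -hd d_base_form scalerA.
Qed.

Definition basis_form (ij : 'I_p * 'I_p) : Om := monomial ij *: omega.

Definition homogeneous_monomial (ij : 'I_p * 'I_p) : {mpoly K[3]} :=
  X ^+ ij.1 * Y ^+ ij.2 * Z ^+ (p.-1 - (ij.1 + ij.2)).

Lemma homogeneous_monomial_homog ij : ij \in low_degree ->
  homogeneous_monomial ij \is p.-1.-homog.
Proof.
rewrite inE => lt_ij.
apply: (dhomogM_eq _ (dhomogM (dhomogXUn _ _ _) (dhomogXUn _ _ _)) (dhomogXUn _ _ _)).
by move: lt_ij; clear; lia.
Qed.

Lemma geval_monomial ij : geval (homogeneous_monomial ij) = monomial ij.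
Proof. by rewrite !rmorphM !rmorphXn /= !gevalX /= expr1n mulr1. Qed.

Lemma homogeneous_sum (c : 'I_p * 'I_p -> K) :
  let G := \sum_(ij in low_degree) (c ij)%:MP * homogeneous_monomial ij in
  G \is p.-1.-homog /\
  geval G = \sum_(ij in low_degree) iota (c ij) * monomial ij.
Proof.
split.
  apply: rpred_sum => ij lt_ij; rewrite mul_mpolyC; apply: dhomogZ.
  exact: homogeneous_monomial_homog.
rewrite rmorph_sum; apply: eq_bigr => ij _.
by rewrite rmorphM /= gevalC geval_monomial.
Qed.

Lemma holomorphicP w : holomorphic iota F x y d w <->
  exists c : 'I_p * 'I_p -> K,
    w = \sum_(ij in low_degree) iota (c ij) *: basis_form ij.
Proof.
have sumE c : \sum_(ij in low_degree) iota (c ij) *: basis_form ij =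
    (\sum_(ij in low_degree) iota (c ij) * monomial ij) *: omega.
  by rewrite scaler_suml; apply: eq_bigr => ij _; rewrite scalerA.
split=> [hol | [c ->]].
  have [c hw] := holomorphic_span hol.
  by exists c; rewrite sumE -hw; apply: holomorphic_base_form.
rewrite sumE; have [homG <-] := homogeneous_sum c.
exact: holomorphic_geval.
Qed.

(** The chart Z <> 0, with coordinates x and y. *)
Definition plane_chart : 'I_3 -> {poly {poly K}} :=
  tnth [tuple 'X%:P; 'X; 1].

(** A relation between the monomials would be a multiple of the equation of the
    curve, which has degree p + 1 in y, while the monomials have degree less
    than p. *)
Lemma basis_form_free (c : 'I_p * 'I_p -> K) :
    \sum_(ij in low_degree) iota (c ij) *: basis_form ij = 0 ->
  {in low_degree, forall ij, c ij = 0}.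
Proof.
move=> c0 [i j] lt_ij.
have [homG gG] := homogeneous_sum c.
have {c0} :
    geval (\sum_(ij in low_degree) (c ij)%:MP * homogeneous_monomial ij) = 0.
  have := congr1 h c0; rewrite linear0 linear_sum gG /= => {2}<-.
  by apply: eq_bigr => ij _; rewrite h_scale h_scale h_base_form mulr1.
move/(geval_eq0_small homG (e := plane_chart)).
have -> : dehomog plane_chart
    (\sum_(ij in low_degree) (c ij)%:MP * homogeneous_monomial ij) =
    \sum_(ij in low_degree) (c ij *: 'X^(ij.1)) *: 'X^(ij.2).
  rewrite rmorph_sum; apply: eq_bigr => ij _.
  rewrite !rmorphM !rmorphXn /= dehomogC !dehomogX /plane_chart !(tnth_nth 0) /=.
  by rewrite expr1n mulr1 -mul_polyC -mul_polyC polyCM -rmorphXn mulrA.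
have lt_sz : (p.+1 < size (dehomog plane_chart F))%N.
  rewrite ltnNge; apply/negP => /leq_sizeP/(_ _ (leqnn _)).
  rewrite dehomog_pellikaan /pellikaan_form /plane_chart !(tnth_nth 0) /=.
  rewrite expr1n !mulr1 !coefD coefCM -rmorphXn coefC coefX coefXn eqxx mulr1.
  rewrite eqSS (gtn_eqF (prime_gt0 p_prime)) !addr0 => /eqP.
  by rewrite polyX_eq0.
have sz_le :
    (size (\sum_(ij in low_degree) (c ij *: 'X^(ij.1)) *: 'X^(ij.2))%R <= p)%N.
  apply: (leq_trans (size_sum _ _ _)); apply/bigmax_leqP => ij _.
  by rewrite (leq_trans (size_scale_leq _ _)) // size_polyXn.
move=> /(_ (leq_ltn_trans (leq_trans sz_le (leqnSn p)) lt_sz)).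
move/(congr1 (fun q : {poly {poly K}} => q`_j`_i)).
rewrite !coef0 coef_sum coef_sum (bigD1 (i, j)) //= !coefZ !coefXn !eqxx.
rewrite !mulr1 coefZ coefXn eqxx mulr1.
rewrite big1 ?addr0 // => -[k l] /andP[_ ne]; rewrite /= coefZ coefXn.
have [Dj | _] := eqVneq (j : nat) l; last by rewrite mulr0 coef0.
rewrite mulr1 coefZ coefXn.
have [Di | _] := eqVneq (i : nat) k; last by rewrite mulr0.
by case/eqP: ne; congr (_, _); apply: val_inj.
Qed.

Lemma pellikaan_genus : has_genus iota F x y d (p * p.+1)./2.
Proof.
rewrite -card_triangle; apply: has_dim_finType holomorphicP _.
exact: basis_form_free.
Qed.

Lemma holomorphic0 : holomorphic iota F x y d 0.
Proof.
apply/holomorphicP; exists (fun=> 0); rewrite big1 // => ij _.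
by rewrite rmorph0 scale0r.
Qed.

Lemma holomorphicD v w : holomorphic iota F x y d v ->
  holomorphic iota F x y d w -> holomorphic iota F x y d (v + w).
Proof.
move=> /holomorphicP[b ->] /holomorphicP[c ->]; apply/holomorphicP.
exists (fun ij => b ij + c ij); rewrite -big_split; apply: eq_bigr => ij _.
by rewrite rmorphD scalerDl.
Qed.

Lemma holomorphicZ c w : holomorphic iota F x y d w ->
  holomorphic iota F x y d (iota c *: w).
Proof.
move=> /holomorphicP[b ->]; apply/holomorphicP.
exists (fun ij => c * b ij); rewrite scaler_sumr; apply: eq_bigr => ij _.
by rewrite rmorphM scalerA.
Qed.

Lemma holomorphic_monomial a b : (a + b < p)%N ->
  holomorphic iota F x y d ((x ^+ a * y ^+ b) *: omega).
Proof.
move=> lt_ab; have [c ->] := span_monomial lt_ab.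
rewrite scaler_suml; apply/holomorphicP; exists c; apply: eq_bigr => ij _.
by rewrite -scalerA.
Qed.

(** * The Cartier operator *)

Variable C : Om -> Om.
Hypothesis C_cartier : cartier p d C.

Lemma cartier0 : C 0 = 0.
Proof.
by apply: (addrI (C 0)); rewrite -(cartierD C_cartier) !addr0.
Qed.

Lemma cartier_sum (I : Type) (r : seq I) (P : pred I) (f : I -> Om) :
  C (\sum_(i <- r | P i) f i) = \sum_(i <- r | P i) C (f i).
Proof. exact: (big_morph C (cartierD C_cartier) cartier0). Qed.

Lemma natr_expp n : n%:R ^+ p = n%:R :> L.
Proof. exact: (pFrobenius_aut_nat charL). Qed.

(** u^a du is d (u^(a+1)) / (a + 1), and a + 1 is a p-th power in L. *)
Lemma cartier_power u a : ~~ (p %| a.+1)%N -> C (u ^+ a *: d u) = 0.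
Proof.
rewrite (dvdn_pcharf charL) => nza.
have := cartier_exact C_cartier (u ^+ a.+1).
rewrite (derivationX d_der) -scalerA -{1}natr_expp (cartierZ C_cartier).
by move/eqP; rewrite scaler_eq0 (negPf nza) => /eqP.
Qed.

(** Replace y^j by (y fy)^j / fy^j = (- x^(p+1))^j / fy^j, and the remaining
    power of 1 / fy by fy^(p-1-j) / fy^p; then expand fy^(p-1-j). *)
Lemma monomial_form_expand i j : (i + j < p)%N ->
  x ^+ i * y ^+ j / fy =
    \sum_(k < (p.-1 - j).+1)
      (fy^-1 * ((-1) ^+ j * x ^+ j * 'C(p.-1 - j, k)%:R * y ^+ k)) ^+ p
        * x ^+ (i + j + k).
Proof.
move=> lt_ij; set m := (p.-1 - j)%N.
have fyE : fy = 1 + y ^+ p * x by rewrite /pellikaan_partial expr1n.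
have yfy : y * fy = - x ^+ p.+1.
  apply/eqP; rewrite -addr_eq0; apply/eqP; rewrite -pellikaan_eq fyE.
  by rewrite [y ^+ p.+1]exprS; ring.
have sgn : ((-1) ^+ j) ^+ p = (-1) ^+ j :> L.
  rewrite -exprM mulnC exprM -(pFrobenius_autE charL).
  by rewrite pFrobenius_autN pFrobenius_aut1.
have pE : (p = j + m + 1)%N by move: lt_ij; rewrite /m; clear; lia.
have -> : x ^+ i * y ^+ j / fy = x ^+ i * (y * fy) ^+ j * fy ^+ m / fy ^+ p.
  have powE (q : L) : q ^+ p = q ^+ j * q ^+ m * q.
    by rewrite [in LHS]pE !exprD expr1.
  rewrite (powE fy) exprMn.
  move: (expf_neq0 j nz_fy) (expf_neq0 m nz_fy) nz_fy.
  move: (fy ^+ j) (fy ^+ m) fy => a b c nza nzb nzc.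
  by field; rewrite nza nzb nzc.
rewrite yfy {1}fyE exprDn mulr_sumr mulr_suml; apply: eq_bigr => k _.
rewrite expr1n mul1r !exprMn sgn natr_expp exprVn -mulr_natr.
rewrite [(- x ^+ p.+1) ^+ j]exprNn.
rewrite exprSr exprMn (exprAC x p j) (exprAC y p k) !exprD.
move: ((x ^+ j) ^+ p) ((y ^+ k) ^+ p) (fy ^+ p)^-1 => a b c; ring.
Qed.

(** Only the term of the expansion with i + j + k = p - 1 contributes, since
    i + j + k + 1 < 2 p. *)
Lemma cartier_monomial i j : (i + j < p)%N ->
  C ((x ^+ i * y ^+ j) *: omega) =
    iota ((-1) ^+ j * 'C(p.-1 - j, i)%:R) *:
      ((x ^+ j * y ^+ (p.-1 - (i + j))) *: omega).
Proof.
move=> lt_ij; rewrite /base_form [X in C X]scalerA monomial_form_expand //.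
rewrite scaler_suml cartier_sum.
have lt_k : (p.-1 - (i + j) < (p.-1 - j).+1)%N by move: lt_ij; clear; lia.
rewrite (bigD1 (Ordinal lt_k)) //= big1 ?addr0 => [|k ne_k].
  rewrite -[X in C X]scalerA (cartierZ C_cartier).
  have -> : (i + j + (p.-1 - (i + j)) = p.-1)%N by move: lt_ij; clear; lia.
  rewrite (cartier_log C_cartier) !scalerA.
  have -> : (p.-1 - (i + j) = p.-1 - j - i)%N by rewrite addnC subnDA.
  rewrite bin_sub; last by move: lt_ij; clear; lia.
  by rewrite rmorphM rmorphXn rmorphN1 rmorph_nat; congr (_ *: _); ring.
rewrite -[X in C X]scalerA (cartierZ C_cartier) cartier_power ?scaler0 //.
apply: contra ne_k => /dvdnP[q Dq]; rewrite -val_eqE /=.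
have q1 : q = 1%N.
  have : (q < 2)%N.
    rewrite -(ltn_pmul2r (prime_gt0 p_prime)) -Dq.
    by have := ltn_ord k; move: lt_ij; clear; lia.
  by case: q Dq => [|[]].
by apply/eqP; move: Dq lt_ij; rewrite q1 mul1n; clear; lia.
Qed.

Lemma cartier_stable w :
  holomorphic iota F x y d w -> holomorphic iota F x y d (C w).
Proof.
move=> /holomorphicP[c ->]; rewrite cartier_sum.
elim/big_ind: _ => [||[i j] lt_ij]; [exact: holomorphic0 | exact: holomorphicD |].
have [e] : exists e, root ('X^p - (c (i, j))%:P) e.
  by apply/closed_rootP; rewrite size_XnsubC ?prime_gt0 // eqSS -lt0n prime_gt0.
rewrite rootE hornerD hornerN hornerXn hornerC subr_eq0 => /eqP <-.
rewrite rmorphXn (cartierZ C_cartier) [C _]cartier_monomial //.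
do 2!apply: holomorphicZ; apply: holomorphic_monomial.
by move: lt_ij; rewrite inE /=; clear; lia.
Qed.

Lemma cartier_onto w : holomorphic iota F x y d w ->
  exists2 v, holomorphic iota F x y d v & C v = w.
Proof.
move=> /holomorphicP[c ->].
elim/big_ind: _ => [|_ _ [v1 hol1 <-] [v2 hol2 <-]|[a b] lt_ab].
- by exists 0; [exact: holomorphic0 | exact: cartier0].
- by exists (v1 + v2); [exact: holomorphicD | exact: (cartierD C_cartier)].
have {}lt_ab : (a + b < p)%N by [].
have lt_ij : (p.-1 - (a + b) + a < p)%N by move: lt_ab; clear; lia.
pose l : K := (-1) ^+ a * 'C(p.-1 - a, p.-1 - (a + b))%:R.
have nzl : l != 0.
  rewrite mulf_neq0 ?signr_eq0 ?(binomial_neq0 charK) //.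
  by move: lt_ab; clear; lia.
(* The monomial with exponents (p-1-a-b, a) is the one that C maps to the
   monomial with exponents (a, b). *)
exists (iota ((c (a, b) / l) ^+ p) *:
  ((x ^+ (p.-1 - (a + b)) * y ^+ a) *: omega)).
  exact/holomorphicZ/holomorphic_monomial.
rewrite rmorphXn (cartierZ C_cartier) cartier_monomial // -/l [LHS]scalerA.
rewrite -rmorphM divfK //.
by have -> : (p.-1 - (p.-1 - (a + b) + a) = b)%N by move: lt_ab; clear; lia.
Qed.

Lemma iter_cartier_image n w : holomorphic iota F x y d w <->
  exists2 v, holomorphic iota F x y d v & w = iter n C v.
Proof.
split=> [hol | [v hol ->]]; last by elim: n => //= n; exact: cartier_stable.
elim: n => [|n [v /cartier_onto[u hol_u <-] ->]]; first by exists w.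
by exists u; rewrite // iterSr.
Qed.

Lemma pellikaan_hasse_witt : has_hasse_witt_invariant iota F x y d C (p * p.+1)./2.
Proof.
have [b [spanb freeb]] := pellikaan_genus.
exists (p * p.+1)./2; first by exists b.
exists b; split=> // w; rewrite -spanb; symmetry; exact: iter_cartier_image.
Qed.

End FunctionField.
End PellikaanCurve.

Theorem theorem6p1 (p : nat) (p_prime : prime p)
    (K : closedFieldType) (j : {rmorphism 'F_p -> K})
    (K_closure : is_algebraic_closure j)
    (L : fieldType) (iota : {rmorphism K -> L}) (x y : L)
    (L_function_field : function_field iota (pellikaan p K) x y)
    (Om : lmodType L) (d : L -> Om) (Om_kahler : kahler iota d)
    (C : Om -> Om) (C_cartier : cartier p d C) :
  has_genus iota (pellikaan p K) x y d (p * p.+1)./2 /\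
  has_hasse_witt_invariant iota (pellikaan p K) x y d C (p * p.+1)./2.
Proof.
have charK : p \in [pchar K] by rewrite (fmorph_pchar j) pchar_Fp.
have [D [D_der Dx Dy]] :=
  jacobian_derivation L_function_field (pellikaan_homog p K).
have [FX FY] := mderiv_pellikaan charK.
rewrite FX FY !geval_partial !gevalX in Dx Dy.
have [h hd _] := kahler_universal Om_kahler D_der.
have d_der := kahler_derivation Om_kahler.
split.
  exact: (pellikaan_genus p_prime charK L_function_field d_der D_der Dx Dy hd).
exact: (pellikaan_hasse_witt p_prime charK L_function_field d_der D_der Dx Dy hd).
Qed.
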